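(* Let $I\subseteq\mathsf{k}[x,y]$ be an anchored, non-principal monomial ideal and let $P=\{g_1,\dots,g_{k+1}\}$ be a set with $P(I)\subseteq P\subseteq P^{\ast}(I)$, where $g_1,\dots,g_{k+1}$ are ordered in descending $y$-degree. Let $D\ge D_P:=(\mu(I)-|P|)\cdot\delta_P+|P|\cdot d_P$ be an integer, set $$r_y(P,D):=\left\lceil D\cdot\max_{1\le i\le k}\frac{\operatorname{dist}_y(I)}{\operatorname{dist}_y(g_i,g_{i+1})}\right\rceil,$$ and let $s\ge D+r_y(P,D)+1$ be an integer. Let $(\mathsf{C}_i)_{i=0}^{k}$ and $(\mathsf{H}_i)_{i=1}^{k}$ be the $(s,y)$-stable components of $I$ with respect to $P$ and $D$. Then for all integers $\ell\ge 0$, $$I^{s+\ell}=\mathsf{C}_0\odot_y \mathsf{H}_1^{\odot_y\ell}\odot_y\mathsf{C}_1\odot_y\mathsf{H}_2^{\odot_y\ell}\odot_y\mathsf{C}_2\odot_y\cdots\odot_y\mathsf{H}_k^{\odot_y\ell}\odot_y\mathsf{C}_k .$$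
   Context: $\mathsf{k}$ is a field, $\mathbb{N}=\{1,2,\dots\}$. For a nonzero monomial ideal $I\subseteq\mathsf{k}[x,y]$: $\mathsf{G}(I)$ is its minimal set of monomial generators, $\mu(I)=|\mathsf{G}(I)|$, $\gcd(I)$ is the greatest common divisor of all monomials in $I$, and $I$ is anchored if $I=I:\gcd(I)$. For $\bullet\in\{x,y\}$, $\operatorname{dist}_\bullet(I):=\max\{\deg_\bullet g\mid g\in\mathsf{G}(I:\gcd(I))\}$; for a set $E$ of monomials, $\operatorname{dist}_\bullet(E)$ is $\operatorname{dist}_\bullet$ of the ideal $(E)$ generated by $E$, and $\operatorname{dist}_\bullet(g,h):=\operatorname{dist}_\bullet(\{g,h\})$. The integral closure $\overline{I}$ is the monomial ideal whose monomials are those $f$ with $f^n\in I^n$ for some $n\in\mathbb{N}$. A generator $f\in\mathsf{G}(I)$ is persistent if $f\notin\overline{(g,h)}$ for all monomials $g,h\in I\setminus\{f\}$; $P(I)$ is the set of persistent generators. $f\in\mathsf{G}(I)$ is weakly persistent if $f^n\in\mathsf{G}(I^n)$ for all $n\in\mathbb{N}$; $P^{\ast}(I)$ is the set of weakly persistent generators (one has $P(I)\subseteq P^{\ast}(I)$). For $P=\{g_1,\dots,g_{k+1}\}$ ordered in descending $y$-degree, $\delta_P:=\max_{1\le i\le k}\min\{\operatorname{dist}_x(g_i,g_{i+1}),\operatorname{dist}_y(g_i,g_{i+1})\}-1$, and $d_P:=\min\{\operatorname{dist}_x(I),\operatorname{dist}_y(I)\}-2$ if $|P|>2$, $d_P:=0$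 if $|P|=2$. Link: for monomial ideals $I,J$, $I\odot_y J:=(I:\gcd(I))\cdot y^{\operatorname{dist}_y(J)}+(J:\gcd(J))\cdot x^{\operatorname{dist}_x(I)}$. This operation is associative; $I^{\odot_y\ell}$ is the $\ell$-fold link of $I$ with itself, and factors with exponent $\ell=0$ are omitted. $r$-segments: let $u,v\in\mathbb{N}$, $J$ an anchored monomial ideal and $r\ge\lceil\operatorname{dist}_y(J)/v\rceil$ an integer. Put $Q:=(x^u,y^v)^{r+1}J$, $L=\{f\in\mathsf{G}(Q)\mid\deg_yf\ge rv\}$, $M=\{f\in\mathsf{G}(Q)\mid rv\le\deg_yf<(r+1)v\}$, $R=\{f\in\mathsf{G}(Q)\mid\deg_yf<rv\}$, and let $g=x^\alpha y^\beta$ be the element of $L$ of smallest $y$-degree. The $r$-segments (with respect to $y$) of $(x^u,y^v)J$ are $\mathsf{A}:=(L):y^\beta$, $\mathsf{H}:=(M\cup\{x^{\alpha-u}y^{\beta+v}\}):x^{\alpha-u}y^\beta$, $\mathsf{B}:=(R\cup\{g\}):x^\alpha$. For monomials $g,h$, the $r$-segments of $(g,h)J$ are those of $(x^u,y^v)J$ with $(x^u,y^v)=(g,h):\gcd(g,h)$. $(s,y)$-stable components of $I$ with respect to $P$ and $D$: put $r:=s-D-1$, $J:=I^D$, $u_i:=\operatorname{dist}_x(g_i,g_{i+1})$, $v_i:=\operatorname{dist}_y(g_i,g_{i+1})$, and for $1\le i\le k$ let $\mathsf{A}_i,\mathsf{H}_i,\mathsf{B}_i$ be the $r$-segments of $(g_i,g_{i+1})J$.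 The components are the ideals $\mathsf{H}_1,\dots,\mathsf{H}_k$ together with $\mathsf{C}_0:=\mathsf{A}_1$, $\mathsf{C}_k:=\mathsf{B}_k$, and for $1\le i<k$ $$\mathsf{C}_i:=\mathsf{B}_i\cdot y^{(r+1)v_{i+1}-\operatorname{dist}_y(\mathsf{B}_{i+1})}+\mathsf{A}_{i+1}\cdot x^{(r+1)u_i-\operatorname{dist}_x(\mathsf{A}_i)} .$$ *)

(* Defs.v *)
From mathcomp Require Import all_boot all_order all_algebra.
From mathcomp Require Import mpoly.
From Stdlib Require Import ClassicalEpsilon.

Set Implicit Arguments.
Unset Strict Implicit.
Unset Printing Implicit Defensive.

Import Order.TTheory GRing.Theory Num.Theory.

Local Open Scope ring_scope.

(* The monomial x^a y^b of k[x,y] is represented by its exponent vector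
   (a, b) : 'X_{1..2}; divisibility of monomials is (_ <= _)%MM. *)
Notation mon := 'X_{1..2}.

Definition vx : 'I_2 := ord0.
Definition vy : 'I_2 := ord_max.

Definition xy (a b : nat) : mon := (U_(vx) *+ a + U_(vy) *+ b)%MM.

(* Ideals are Prop-valued predicates closed under the ideal operations (the
   library's idealr_closed is boolean and only covers proper ideals).  Equality
   of ideals is extensional equality. *)
Definition ideal (K : fieldType) := {mpoly K[2]} -> Prop.

Definition eq_ideal (K : fieldType) (I J : ideal K) : Prop :=
  forall p, I p <-> J p.

Definition is_ideal (K : fieldType) (I : ideal K) : Prop :=
  [/\ I 0, forall p q, I p -> I q -> I (p + q) & forall p q, I q -> I (p * q)].

Definition ideal_gen (K : fieldType) (E : {mpoly K[2]} -> Prop) : ideal K :=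
  fun p => forall J : ideal K, is_ideal J -> (forall q, E q -> J q) -> J p.

Definition mon_gen (K : fieldType) (E : mon -> Prop) : ideal K :=
  ideal_gen (fun p => exists2 m, E m & p = 'X_[m]).
Arguments mon_gen K E _ : clear implicits.

Definition mon_gens (K : fieldType) (s : seq mon) : ideal K :=
  mon_gen K (fun m => m \in s).
Arguments mon_gens K s _ : clear implicits.

Definition monomial_ideal (K : fieldType) (I : ideal K) : Prop :=
  exists E : mon -> Prop, eq_ideal I (mon_gen K E).

Definition principal (K : fieldType) (I : ideal K) : Prop :=
  exists p, eq_ideal I (ideal_gen (fun q => q = p)).

Definition ideal_add (K : fieldType) (I J : ideal K) : ideal K :=
  ideal_gen (fun p => I p \/ J p).

Definition ideal_mul (K : fieldType) (I J : ideal K) : ideal K :=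
  ideal_gen (fun p => exists q r, [/\ I q, J r & p = q * r]).

Definition ideal_pow (K : fieldType) (I : ideal K) (n : nat) : ideal K :=
  iter n (ideal_mul I) (fun _ => True).

Definition ideal_scale (K : fieldType) (I : ideal K) (m : mon) : ideal K :=
  ideal_mul I (mon_gens K [:: m]).

Definition colon (K : fieldType) (I : ideal K) (m : mon) : ideal K :=
  fun p => I (p * 'X_[m]).

Definition is_mingens (K : fieldType) (I : ideal K) (s : seq mon) : Prop :=
  [/\ uniq s, eq_ideal (mon_gens K s) I &
      forall t : seq mon, {subset t <= s} -> eq_ideal (mon_gens K t) I ->
        {subset s <= t}].

(* G(I).  Every monomial ideal has exactly one minimal set of monomial
   generators, and it is finite; the choice made by epsilon is only that of an
   enumeration of this set. *)
Definition mingens (K : fieldType) (I : ideal K) : seq mon :=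
  epsilon (inhabits [::]) (is_mingens I).

Definition mu (K : fieldType) (I : ideal K) : nat := size (mingens I).

Definition mon_dvd_all (K : fieldType) (I : ideal K) (d : mon) : Prop :=
  forall m : mon, I 'X_[m] -> (d <= m)%MM.

Definition is_gcd (K : fieldType) (I : ideal K) (d : mon) : Prop :=
  mon_dvd_all I d /\ forall e, mon_dvd_all I e -> (e <= d)%MM.

(* gcd(I): it exists and is unique as soon as I contains a monomial. *)
Definition gcd_ideal (K : fieldType) (I : ideal K) : mon :=
  epsilon (inhabits 0%MM) (is_gcd I).

Definition anchor (K : fieldType) (I : ideal K) : ideal K :=
  colon I (gcd_ideal I).

Definition anchored (K : fieldType) (I : ideal K) : Prop :=
  eq_ideal I (anchor I).

Definition dist (K : fieldType) (i : 'I_2) (I : ideal K) : nat :=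
  (\max_(g <- mingens (anchor I)) g i)%N.

Definition dist_pair (K : fieldType) (i : 'I_2) (g h : mon) : nat :=
  dist i (mon_gens K [:: g; h]).
Arguments dist_pair K i g h : clear implicits.

Definition int_closure (K : fieldType) (I : ideal K) : ideal K :=
  mon_gen K (fun f : mon => exists n : nat,
    (0 < n)%N /\ ideal_pow I n ('X_[f] ^+ n)).

Definition persistent (K : fieldType) (I : ideal K) (f : mon) : Prop :=
  f \in mingens I /\
  forall g h : mon, I 'X_[g] -> g <> f -> I 'X_[h] -> h <> f ->
    ~ int_closure (mon_gens K [:: g; h]) 'X_[f].

Definition weakly_persistent (K : fieldType) (I : ideal K) (f : mon) : Prop :=
  f \in mingens I /\
  forall n : nat, (0 < n)%N -> (f *+ n)%MM \in mingens (ideal_pow I n).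

(* P = {g_1, ..., g_(k+1)} is the duplicate-free sequence of its elements in
   descending y-degree; indices start at 1, and k = (size P).-1. *)
Definition gen_at (P : seq mon) (i : nat) : mon := nth 0%MM P i.-1.

Definition u_at (K : fieldType) (P : seq mon) (i : nat) : nat :=
  dist_pair K vx (gen_at P i) (gen_at P i.+1).
Arguments u_at K P i : clear implicits.

Definition v_at (K : fieldType) (P : seq mon) (i : nat) : nat :=
  dist_pair K vy (gen_at P i) (gen_at P i.+1).
Arguments v_at K P i : clear implicits.

(* If I is anchored and non-principal and P(I) <= P <= P*(I), no subtraction on
   nat below is truncated: then 2 <= |P| <= mu(I), all u_i and v_i are positive,
   and |P| > 2 forces dist_x(I), dist_y(I) >= 2. *)
Definition delta (K : fieldType) (P : seq mon) : nat :=
  ((\max_(1 <= i < size P) minn (u_at K P i) (v_at K P i)) - 1)%N.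
Arguments delta K P : clear implicits.

Definition d_ (K : fieldType) (I : ideal K) (P : seq mon) : nat :=
  if (2 < size P)%N then (minn (dist vx I) (dist vy I) - 2)%N else 0%N.

Definition D_ (K : fieldType) (I : ideal K) (P : seq mon) : nat :=
  ((mu I - size P) * delta K P + size P * d_ I P)%N.

Definition r_y (K : fieldType) (I : ideal K) (P : seq mon) (D : nat) : int :=
  Num.ceil (D%:R * \big[Num.max/0]_(1 <= i < size P)
                     ((dist vy I)%:R / (v_at K P i)%:R) : rat).

Definition link (K : fieldType) (I J : ideal K) : ideal K :=
  ideal_add (ideal_scale (anchor I) (xy 0 (dist vy J)))
            (ideal_scale (anchor J) (xy (dist vx I) 0)).

(* The r-segments of (x^u, y^v) J.  They are meant for u, v > 0, J anchored and
   dist_y(J) <= r v; in that case L is nonempty and contains an element g of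
   smallest y-degree, whose x-degree alpha is at least u. *)
Section Segments.
Variables (K : fieldType) (u v r : nat) (J : ideal K).

Definition seg_gens : seq mon :=
  mingens (ideal_mul (ideal_pow (mon_gens K [:: xy u 0; xy 0 v]) r.+1) J).

Definition seg_L : seq mon := [seq f : mon <- seg_gens | (r * v <= f vy)%N].

Definition seg_M : seq mon :=
  [seq f : mon <- seg_gens | (r * v <= f vy < r.+1 * v)%N].

Definition seg_R : seq mon := [seq f : mon <- seg_gens | (f vy < r * v)%N].

Definition seg_g : mon :=
  head 0%MM (sort (fun f h : mon => (f vy <= h vy)%N) seg_L).

Definition seg_A : ideal K := colon (mon_gens K seg_L) (xy 0 (seg_g vy)).

Definition seg_H : ideal K :=
  colon (mon_gens K (xy (seg_g vx - u)%N (seg_g vy + v)%N :: seg_M))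
        (xy (seg_g vx - u)%N (seg_g vy)).

Definition seg_B : ideal K :=
  colon (mon_gens K (seg_g :: seg_R)) (xy (seg_g vx) 0).

End Segments.

(* The (s,y)-stable components of I with respect to P and D, where
   (g, h) : gcd(g, h) = (x^u, y^v) with u = dist_x(g, h), v = dist_y(g, h). *)
Section StableComponents.
Variables (K : fieldType) (I : ideal K) (P : seq mon) (D s : nat).

Let r : nat := (s - D - 1)%N.
Let k : nat := (size P).-1.

Definition comp_A (i : nat) : ideal K :=
  seg_A (u_at K P i) (v_at K P i) r (ideal_pow I D).

Definition comp_H (i : nat) : ideal K :=
  seg_H (u_at K P i) (v_at K P i) r (ideal_pow I D).

Definition comp_B (i : nat) : ideal K :=
  seg_B (u_at K P i) (v_at K P i) r (ideal_pow I D).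

Definition comp_C (i : nat) : ideal K :=
  if i == 0%N then comp_A 1
  else if i == k then comp_B k
  else ideal_add
    (ideal_scale (comp_B i)
       (xy 0 (r.+1 * v_at K P i.+1 - dist vy (comp_B i.+1))%N))
    (ideal_scale (comp_A i.+1)
       (xy (r.+1 * u_at K P i - dist vx (comp_A i))%N 0)).

(* C_0 (.) H_1^l (.) C_1 (.) ... (.) H_k^l (.) C_k, bracketed to the left. *)
Definition stable_link (l : nat) : ideal K :=
  foldl (@link K) (comp_C 0)
    (flatten [seq rcons (nseq l (comp_H i)) (comp_C i) | i <- iota 1 k]).

End StableComponents.

(* Main.v *)
Require Import Defs.
From mathcomp Require Import all_boot all_order all_algebra.
From mathcomp Require Import mpoly zify.
From Stdlib Require Import ClassicalEpsilon FunctionalExtensionality.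
From Stdlib Require Import PropExtensionality.

Set Implicit Arguments.
Unset Strict Implicit.
Unset Printing Implicit Defensive.

Import Order.TTheory GRing.Theory Num.Theory.

(** A monomial ideal of k[x,y] is a set of exponents closed under going up and
to the right.  If it contains a power of x and a power of y, as every nonzero
anchored ideal does, this set consists of the points (a, b) with F b <= a for
a nonincreasing function F that is eventually 0: its profile.  The minimal
generators are the points (F b, b) at which F drops, dist_x is F 0, dist_y is
the first zero of F, and linking two ideals concatenates the graphs of their
profiles ([link_slice]).  So the theorem says that the graph of the
profile Phi of I^(s+l) can be cut into consecutive pieces, namely C_0, then l
copies of H_1, then C_1, and so on.

The first ingredient is that I^t is the sum of the ideals
(g_i, g_(i+1))^(t-D) I^D for t >= D ([pow_decomposition]).  In a product of t
generators, many equal factors outside P can be exchanged for elements of P,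
since each of them lies on or above the segment joining two neighbours g_i,
g_(i+1); and many factors g_i and g_j that are not neighbours can be exchanged
for an intermediate g_m, since g_m lies on or below the segment from g_i to
g_j.  When no exchange is left, at most D factors lie outside one pair of
neighbours.  The first position holds because a linear form, slightly tilted,
attains its minimum over I at a single generator, and such a generator is
persistent ([persistent_of_linear], [above_chain]); the second holds because a
point of I^n to the lower left of n g_m would contradict the weak persistence
of g_m ([weakly_persistent_convex]).

The second ingredient is the shape of (x^u, y^v)^n J.  Write h for the profile
of J and Y for dist_y(J).  Passing from n to n+1 moves the profile right by u
below height (n+1) v, and moves it up by v above height Y
([stairpowS_left], [stairpowS_right]).  As Y <= r v, both descriptions apply
between the heights r v and (r+1) v, so increasing n by l inserts there l
copies of one period.  The segments A, H, B are the parts above, inside and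
below that period, cut at the lowest generator of y-degree at least r v
([seg_AE], [seg_HE], [seg_BE]).

Finally, for N = s + l - D, the profile of I^(s+l) is the minimum of the
profiles of the summands, and on the i-th periodic stretch only the i-th
summand matters: the later ones start too far right and the earlier ones too
high ([Phi_region]).  Between two such stretches exactly two summands compete
([Phi_between]), and their overlay is C_i.  Gluing the pieces from the top to
the bottom gives the formula ([power_stable_link]). *)

(** * Monomial ideals as regions of the exponent plane *)

Lemma argmin_nat (T : Type) (Q : T -> Prop) (p : T -> nat) x0 :
  Q x0 -> exists x, Q x /\ forall y, Q y -> p x <= p y.
Proof.
have [n] := ubnP (p x0); elim: n x0 => // n IHn x0 ltn Qx0.
case: (classic (exists2 y, Q y & p y < p x0)) => [[y Qy lty] | nex].
  by apply: (IHn y) => //; apply: leq_trans lty _.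
exists x0; split=> // y Qy; rewrite leqNgt; apply/negP => lt.
by apply: nex; exists y.
Qed.

(** Extensionality lets equalities of ideals be used for rewriting. *)
Lemma eq_ideal_eq (K : fieldType) (I J : ideal K) : eq_ideal I J -> I = J.
Proof.
by move=> eqIJ; apply: functional_extensionality => p; apply: propositional_extensionality.
Qed.

Lemma xy_vx a b : xy a b vx = a.
Proof. by rewrite mnmDE !mulmnE !mnm1E mul1n mul0n addn0. Qed.

Lemma xy_vy a b : xy a b vy = b.
Proof. by rewrite mnmDE !mulmnE !mnm1E mul1n mul0n. Qed.

Lemma ord2P (i : 'I_2) : i = vx \/ i = vy.
Proof.
by case: i => [[|[|i]]] //= lti; [left | right]; apply: val_inj.
Qed.

Lemma mon_ext (m m' : mon) : m vx = m' vx -> m vy = m' vy -> m = m'.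
Proof. by move=> ex ey; apply/mnmP => i; case: (ord2P i) => ->. Qed.

Lemma mon_eta (m : mon) : m = xy (m vx) (m vy).
Proof. by apply: mon_ext; rewrite ?xy_vx ?xy_vy. Qed.

Lemma mon_leP (m m' : mon) :
  reflect (m vx <= m' vx /\ m vy <= m' vy) (m <= m')%MM.
Proof.
apply: (iffP mnm_lepP) => [le_mm' | [lex ley] i]; first by split; apply: le_mm'.
by case: (ord2P i) => ->.
Qed.

Definition region := nat -> nat -> Prop.

Definition upset (T : region) : Prop :=
  forall a b a' b', a <= a' -> b <= b' -> T a b -> T a' b'.

Definition ideal_of (K : fieldType) (T : region) : ideal K :=
  fun p => forall m, m \in msupp p -> T (m vx) (m vy).
Arguments ideal_of K T _ : clear implicits.

Lemma ideal_of_ext (K : fieldType) (T U : region) :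
  (forall a b, T a b <-> U a b) -> ideal_of K T = ideal_of K U.
Proof.
by move=> eqTU; apply: eq_ideal_eq => p; split=> Tp m /Tp /eqTU.
Qed.

Lemma ideal_of_mon (K : fieldType) (T : region) (m : mon) :
  ideal_of K T ('X_[m])%R <-> T (m vx) (m vy).
Proof.
split=> [Tm | Tm m']; first by apply: Tm; rewrite msuppX mem_head.
by rewrite msuppX mem_seq1 => /eqP ->.
Qed.

Lemma ideal_of_inj (K : fieldType) (T U : region) :
  ideal_of K T = ideal_of K U -> forall a b, T a b = U a b.
Proof.
move=> eqTU a b; apply: propositional_extensionality.
move: (ideal_of_mon K T (xy a b)) (ideal_of_mon K U (xy a b)).
by rewrite eqTU xy_vx xy_vy => -> ->.
Qed.

(** Multiplying by a polynomial only adds exponents to those of the support. *)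
Lemma ideal_of_is_ideal (K : fieldType) (T : region) : upset T -> is_ideal (ideal_of K T).
Proof.
move=> upT; split=> [m | p q Tp Tq m | p q Tq m].
- by rewrite msupp0.
- by move/msuppD_le; rewrite mem_cat => /orP[/Tp | /Tq].
move/msuppM_le => /allpairsP[[m1 m2] /= [_ /Tq Tm2 ->]].
by apply: upT Tm2; rewrite mnmDE leq_addl.
Qed.

Lemma ideal_mem_supp (K : fieldType) (I : ideal K) p :
  is_ideal I -> (forall m, m \in msupp p -> I 'X_[m])%R -> I p.
Proof.
move=> [I0 ID IM] Isupp; rewrite [p]mpolyE big_seq; elim/big_rec: _ => // m q.
by move=> /Isupp Im Iq; apply: ID Iq; rewrite -mul_mpolyC; apply: IM.
Qed.

Lemma ideal_gen_is_ideal (K : fieldType) (E : {mpoly K[2]} -> Prop) :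
  is_ideal (ideal_gen E).
Proof.
split=> [J [] // | p q Ip Iq J idJ EJ | p q Iq J idJ EJ].
- by case: (idJ) => _ JD _; apply: JD; [apply: Ip | apply: Iq].
by case: (idJ) => _ _ JM; apply: JM; apply: Iq.
Qed.

Lemma ideal_gen_sub (K : fieldType) (E : {mpoly K[2]} -> Prop) p :
  E p -> ideal_gen E p.
Proof. by move=> Ep J _; apply. Qed.

(** Both inclusions are checked on monomials: the right-hand side is an ideal
because [T] is an up-set, and a polynomial is a combination of the monomials
of its support. *)
Lemma ideal_genE (K : fieldType) (E : {mpoly K[2]} -> Prop) (T : region) :
  upset T -> (forall p, E p -> ideal_of K T p) ->
  (forall a b, T a b -> exists2 p, E p & exists q, 'X_[xy a b] = q * p)%R ->
  ideal_gen E = ideal_of K T.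
Proof.
move=> upT ET TE; apply: eq_ideal_eq => p; split=> [Ip | Tp].
  exact: (Ip _ (ideal_of_is_ideal K upT) ET).
apply: ideal_mem_supp (ideal_gen_is_ideal E) _ => m /Tp /TE[q Eq [q']].
rewrite -mon_eta => ->.
by case: (ideal_gen_is_ideal E) => _ _; apply; apply: ideal_gen_sub.
Qed.

Lemma monX_dvd (K : fieldType) (m m' : mon) :
  (m <= m')%MM -> exists q : {mpoly K[2]}, ('X_[m'] = q * 'X_[m])%R.
Proof. by move=> le; exists 'X_[m' - m]%R; rewrite -mpolyXD submK. Qed.

Definition up (E : mon -> Prop) : region :=
  fun a b => exists2 m, E m & m vx <= a /\ m vy <= b.

Lemma up_upset E : upset (up E).
Proof. by move=> a b a' b' lea leb [m Em [le1 le2]]; exists m => //; lia. Qed.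

Lemma mon_gen_region (K : fieldType) (E : mon -> Prop) :
  mon_gen K E = ideal_of K (up E).
Proof.
apply: ideal_genE (@up_upset E) _ _ => [p [m Em ->] | a b [m Em lem]].
  by apply/ideal_of_mon; exists m.
exists 'X_[m]%R; first by exists m.
by apply: monX_dvd; apply/mon_leP; rewrite xy_vx xy_vy.
Qed.

Lemma ideal_add_region (K : fieldType) (T U : region) :
  upset T -> upset U ->
  ideal_add (ideal_of K T) (ideal_of K U) = ideal_of K (fun a b => T a b \/ U a b).
Proof.
move=> upT upU; apply: ideal_genE => [a b a' b' lea leb [TU | TU] | p | a b TU].
- by left; apply: upT TU.
- by right; apply: upU TU.
- by case=> Tp m /Tp; tauto.
exists 'X_[xy a b]%R; last by exists 1%R; rewrite mul1r.
by rewrite !ideal_of_mon xy_vx xy_vy.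
Qed.

Definition region_mul (T U : region) : region := fun a b =>
  exists a1 b1 a2 b2, [/\ T a1 b1, U a2 b2, a = a1 + a2 & b = b1 + b2].

Lemma region_mul_upset T U : upset U -> upset (region_mul T U).
Proof.
move=> upU a b a' b' lea leb [a1 [b1 [a2 [b2 [T1 U2 ea eb]]]]].
exists a1, b1, (a' - a1), (b' - b1); split=> //; try lia.
by apply: upU U2; lia.
Qed.

Lemma ideal_mul_region (K : fieldType) (T U : region) :
  upset U -> ideal_mul (ideal_of K T) (ideal_of K U) = ideal_of K (region_mul T U).
Proof.
move=> upU; apply: ideal_genE => [| p [q [q' [Tq Uq ->]]] m | a b].
- exact: region_mul_upset.
- move/msuppM_le => /allpairsP[[m1 m2] /= [/Tq T1 /Uq U2 ->]].
  by exists (m1 vx), (m1 vy), (m2 vx), (m2 vy); rewrite !mnmDE.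
move=> [a1 [b1 [a2 [b2 [T1 U2 -> ->]]]]].
exists ('X_[xy a1 b1] * 'X_[xy a2 b2])%R.
  by exists 'X_[xy a1 b1]%R, 'X_[xy a2 b2]%R; split=> //; apply/ideal_of_mon; rewrite xy_vx xy_vy.
exists 1%R; rewrite mul1r -mpolyXD; congr ('X_[_])%R.
by apply: mon_ext; rewrite mnmDE ?xy_vx ?xy_vy.
Qed.

Fixpoint region_pow (T : region) n : region :=
  if n is n'.+1 then region_mul T (region_pow T n') else fun _ _ => True.

Lemma region_pow_upset T n : upset (region_pow T n).
Proof. by elim: n => [|n IHn] //=; apply: region_mul_upset. Qed.

Lemma ideal_pow_region (K : fieldType) (T : region) n :
  ideal_pow (ideal_of K T) n = ideal_of K (region_pow T n).
Proof.
rewrite /ideal_pow; elim: n => [|n IHn] /=.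
  by apply: eq_ideal_eq => p; split.
by rewrite IHn ideal_mul_region //; apply: region_pow_upset.
Qed.

Lemma colon_region (K : fieldType) (T : region) (m : mon) :
  colon (ideal_of K T) m = ideal_of K (fun a b => T (a + m vx) (b + m vy)).
Proof.
apply: eq_ideal_eq => p; split=> Tp m'.
  rewrite mcoeff_msupp => nz; have := Tp (m + m')%MM.
  by rewrite mcoeff_msupp mcoeffMX !mnmDE ![m _ + _]addnC; apply.
rewrite (perm_mem (msuppMX _ _)) => /mapP[m1 /Tp T1 ->].
by rewrite !mnmDE ![m _ + _]addnC.
Qed.

Lemma scale_region (K : fieldType) (T : region) (m : mon) :
  upset T -> ideal_scale (ideal_of K T) m =
    ideal_of K (fun a b => [/\ m vx <= a, m vy <= b & T (a - m vx) (b - m vy)]).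
Proof.
move=> upT; rewrite /ideal_scale /mon_gens mon_gen_region ideal_mul_region; last exact: up_upset.
apply: ideal_of_ext => a b; split.
  move=> [a1 [b1 [a2 [b2 [T1 [m']]]]]]; rewrite mem_seq1 => /eqP -> [lex ley] -> ->.
  by split; [lia | lia | apply: upT T1; lia].
move=> [lex ley T1]; exists (a - m vx), (b - m vy), (m vx), (m vy).
by split=> //; [exists m; rewrite ?mem_head | lia | lia].
Qed.

Lemma shift_upset (T : region) c d : upset T ->
  upset (fun a b => [/\ c <= a, d <= b & T (a - c) (b - d)]).
Proof.
move=> upT a b a' b' lea leb [le1 le2 T1].
by split; [lia | lia | apply: upT T1; rewrite leq_sub2r].
Qed.

Lemma monomial_ideal_region (K : fieldType) (I : ideal K) :
  monomial_ideal I -> exists2 T, upset T & I = ideal_of K T.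
Proof.
move=> [E /eq_ideal_eq ->]; exists (up E); first exact: up_upset.
exact: mon_gen_region.
Qed.

(** * Staircase profiles *)

Definition antitone (F : nat -> nat) : Prop := forall b b', b <= b' -> F b' <= F b.

(** Together with [antitone], this characterizes the profiles of the monomial
ideals that contain a power of x and a power of y. *)
Definition vanishes (F : nat -> nat) : Prop := exists b, F b = 0.

Definition right_of (F : nat -> nat) : region := fun a b => F b <= a.

(** These heights are the y-degrees of the minimal generators. *)
Definition corner (F : nat -> nat) (b : nat) : bool := all (fun z => F b < F z) (iota 0 b).

Lemma cornerP F b : reflect (forall z, z < b -> F b < F z) (corner F b).
Proof.
apply: (iffP allP) => [dr z ltz | dr z]; first by apply: dr; rewrite mem_iota.
by rewrite mem_iota => /andP[_ /dr].
Qed.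

Lemma right_of_upset F : antitone F -> upset (right_of F).
Proof.
move=> aF a b a' b' lea leb Fab; apply: leq_trans lea.
exact: leq_trans (aF _ _ leb) Fab.
Qed.

(** Every point of the graph lies straight above a generator: take the lowest
point of its vertical segment. *)
Lemma last_corner F b : antitone F ->
  exists z, [/\ z <= b, corner F z, F z = F b & forall c, corner F c -> c <= b -> c <= z].
Proof.
move=> aF.
case: (@ex_minnP (fun z => F z == F b)) => [|z /eqP eqz minz]; first by exists b.
have lezb : z <= b by apply: minz.
exists z; split=> // [|c /cornerP dc lecb].
  apply/cornerP => z' lt'; rewrite ltn_neqAle aF 1?ltnW // andbT.
  apply/eqP => eqz'; have := minz z'; rewrite -eqz' eqz eqxx => /(_ isT).
  by rewrite leqNgt lt'.
rewrite leqNgt; apply/negP => /dc; rewrite eqz ltnNge; move/negP; apply.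
exact: aF.
Qed.

Definition corners (F : nat -> nat) (B : nat) : seq mon :=
  [seq xy (F b) b | b <- iota 0 B.+1 & corner F b].

Lemma mem_corners F B m : F B = 0 ->
  (m \in corners F B) = (m vx == F (m vy)) && corner F (m vy).
Proof.
move=> FB; apply/mapP/andP => [[b] | [/eqP ex dr]].
  by rewrite mem_filter => /andP[dr _] ->; rewrite xy_vx xy_vy.
exists (m vy); last by apply: mon_ext; rewrite ?xy_vx ?xy_vy.
rewrite mem_filter dr mem_iota add0n ltnS /= leqNgt; apply/negP => ltB.
by have /cornerP/(_ B ltB) := dr; rewrite FB ltn0.
Qed.

Lemma corners_uniq F B : uniq (corners F B).
Proof.
rewrite map_inj_uniq ?filter_uniq ?iota_uniq // => b b' eqb.
by rewrite -(xy_vy (F b) b) eqb xy_vy.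
Qed.

Lemma up_corners F B : antitone F -> F B = 0 ->
  forall a b, up (fun m => m \in corners F B) a b <-> right_of F a b.
Proof.
move=> aF FB a b; split=> [[m] | le_a].
  rewrite mem_corners // => /andP[/eqP ex _] [lex ley].
  by apply: leq_trans lex; rewrite ex; apply: aF.
have [z [lezb dz eqz _]] := last_corner b aF.
exists (xy (F z) z); rewrite ?mem_corners // xy_vx xy_vy ?eqxx //.
by rewrite eqz.
Qed.

Lemma mon_gens_corners (K : fieldType) F B : antitone F -> F B = 0 ->
  mon_gens K (corners F B) = ideal_of K (right_of F).
Proof.
by move=> aF FB; rewrite /mon_gens mon_gen_region; apply: ideal_of_ext; apply: up_corners.
Qed.

Lemma corners_right_of F B m : F B = 0 -> m \in corners F B -> right_of F (m vx) (m vy).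
Proof. by move=> FB; rewrite mem_corners // => /andP[/eqP -> _]; apply: leqnn. Qed.

Lemma corners_minimal F B (m m' : mon) : F B = 0 -> m \in corners F B ->
  right_of F (m' vx) (m' vy) -> m' vx <= m vx -> m' vy <= m vy -> m' = m.
Proof.
move=> FB; rewrite mem_corners // => /andP[/eqP mx /cornerP md] Fm' lex ley.
have eqy : m' vy = m vy.
  apply/eqP; rewrite eqn_leq ley leqNgt; apply/negP => lt.
  have := md _ lt; rewrite -mx ltnNge => /negP; apply.
  exact: leq_trans Fm' lex.
apply: mon_ext => //; apply/eqP; rewrite eqn_leq lex mx -eqy.
exact: Fm'.
Qed.

Lemma is_mingens_corners (K : fieldType) F B : antitone F -> F B = 0 ->
  is_mingens (ideal_of K (right_of F)) (corners F B).
Proof.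
move=> aF FB; split=> [||t subt eqt m mc]; first exact: corners_uniq.
  by rewrite mon_gens_corners.
move/eq_ideal_eq: eqt; rewrite /mon_gens mon_gen_region => /ideal_of_inj eqtF.
have : up (fun x => x \in t) (m vx) (m vy) by rewrite eqtF; apply: corners_right_of FB mc.
move=> [e et [lex ley]]; suff <- : e = m by [].
exact: corners_minimal FB mc (corners_right_of FB (subt _ et)) lex ley.
Qed.

(** Uniqueness of the minimal generators: each corner has no other element of
the region to its lower left, so it occurs in every generating set, and the
corners alone generate. *)
Lemma is_mingens_sub (K : fieldType) F B s : antitone F -> F B = 0 ->
  is_mingens (ideal_of K (right_of F)) s -> s =i corners F B.
Proof.
move=> aF FB [_ eqs mins].
move/eq_ideal_eq: (eqs); rewrite /mon_gens mon_gen_region => /ideal_of_inj eqsF.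
have sub1 : {subset corners F B <= s}.
  move=> m mc; have [e es [lex ley]] : up (fun x => x \in s) (m vx) (m vy).
    by rewrite eqsF; apply: corners_right_of FB mc.
  suff <- : e = m by [].
  by apply: corners_minimal FB mc _ lex ley; rewrite -eqsF; exists e.
move=> m; apply/idP/idP; last exact: sub1.
have := mins [seq x <- s | x \in corners F B].
have sub2 : {subset [seq x <- s | x \in corners F B] <= s}.
  by apply: mem_subseq; apply: filter_subseq.
move=> /(_ sub2); have -> : mon_gens K [seq x <- s | x \in corners F B] = ideal_of K (right_of F).
  rewrite -(mon_gens_corners K aF FB) /mon_gens; congr mon_gen.
  apply: functional_extensionality => x; apply: propositional_extensionality.
  rewrite mem_filter; split=> [/andP[] //|xc]; by rewrite xc sub1.
by move=> /(_ (fun p => conj id id)) sub ms; have := sub _ ms; rewrite mem_filter => /andP[].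
Qed.

Lemma mingens_right_of (K : fieldType) F : antitone F -> vanishes F ->
  uniq (mingens (ideal_of K (right_of F))) /\
  forall m, (m \in mingens (ideal_of K (right_of F))) = (m vx == F (m vy)) && corner F (m vy).
Proof.
move=> aF [B FB].
have exm : exists s, is_mingens (ideal_of K (right_of F)) s.
  by exists (corners F B); apply: is_mingens_corners.
have spec := epsilon_spec (inhabits [::]) _ exm.
split; first by case: spec.
by move=> m; rewrite -(mem_corners m FB); exact: (is_mingens_sub aF FB spec).
Qed.

Lemma up_mingens (K : fieldType) F : antitone F -> vanishes F ->
  up (fun m => m \in mingens (ideal_of K (right_of F))) = right_of F.
Proof.
move=> aF vF; have [B FB] := vF; have [_ memI] := mingens_right_of K aF vF.
apply: functional_extensionality => x; apply: functional_extensionality => y.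
apply: propositional_extensionality; rewrite -(up_corners aF FB).
by split=> -[m mE le]; exists m => //; move: mE; rewrite memI mem_corners.
Qed.

Lemma gcd_idealE (K : fieldType) (I : ideal K) d : is_gcd I d -> gcd_ideal I = d.
Proof.
move=> gd; have [dvd maxd] := gd.
have [dvd' maxd'] := epsilon_spec (inhabits 0%MM) _ (ex_intro _ d gd).
have /mon_leP[??] := maxd _ dvd'; have /mon_leP[??] := maxd' _ dvd.
by apply: mon_ext; apply/eqP; rewrite eqn_leq; apply/andP.
Qed.

(** A power of x and a power of y have no common divisor. *)
Lemma anchor_right_of (K : fieldType) F : antitone F -> vanishes F ->
  anchor (ideal_of K (right_of F)) = ideal_of K (right_of F).
Proof.
move=> aF [B FB]; rewrite /anchor (@gcd_idealE _ _ 0%MM).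
  by rewrite colon_region; apply: ideal_of_ext => a b; rewrite !mnm0E !addn0.
split=> [m _ | e dvd]; first by apply/mon_leP; rewrite !mnm0E.
apply/mon_leP; rewrite (mnm0E vx) (mnm0E vy); split.
  have /mon_leP[] : (e <= xy 0 B)%MM; last by rewrite xy_vx.
  by apply: dvd; apply/ideal_of_mon; rewrite /right_of xy_vx xy_vy FB.
have /mon_leP[_] : (e <= xy (F 0%N) 0)%MM; last by rewrite xy_vy.
by apply: dvd; apply/ideal_of_mon; rewrite /right_of xy_vx xy_vy.
Qed.

Lemma dist_vx_right_of (K : fieldType) F : antitone F -> vanishes F ->
  dist vx (ideal_of K (right_of F)) = F 0.
Proof.
move=> aF vF; rewrite /dist anchor_right_of //; have [_ memF] := mingens_right_of K aF vF.
apply/eqP; rewrite eqn_leq; apply/andP; split.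
  apply/bigmax_leqP_seq => m; rewrite memF => /andP[/eqP -> _] _.
  exact: aF.
rewrite -[X in X <= _](xy_vx _ 0); apply: leq_bigmax_seq => //.
by rewrite memF xy_vx xy_vy eqxx.
Qed.

Lemma dist_vy_right_of (K : fieldType) F B : antitone F -> F B = 0 -> corner F B ->
  dist vy (ideal_of K (right_of F)) = B.
Proof.
move=> aF FB dB; have vF : vanishes F by exists B.
rewrite /dist anchor_right_of //; have [_ memF] := mingens_right_of K aF vF.
apply/eqP; rewrite eqn_leq; apply/andP; split.
  apply/bigmax_leqP_seq => m; rewrite memF => /andP[_ /cornerP dm] _.
  by rewrite leqNgt; apply/negP => /dm; rewrite FB ltn0.
rewrite -[X in X <= _](xy_vy 0 B); apply: leq_bigmax_seq => //.
by rewrite memF xy_vx xy_vy FB dB.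
Qed.

(** The profile at height [b] is the least admissible x-degree there. *)
Lemma upset_right_of (T : region) a0 b0 : upset T -> T a0 0 -> T 0 b0 ->
  exists F, [/\ antitone F, F b0 = 0 & forall a b, T a b <-> right_of F a b].
Proof.
move=> upT Ta Tb.
have least b : exists x, T x b /\ forall x', T x' b -> x <= x'.
  by apply: (argmin_nat id (x0 := a0)); apply: upT Ta.
pose F b := epsilon (inhabits 0) (fun x => T x b /\ forall x', T x' b -> x <= x').
have specF b : T (F b) b /\ forall x', T x' b -> F b <= x' by apply: epsilon_spec (least b).
exists F; split=> [b b' leb || a b].
- by case: (specF b') => _; apply; case: (specF b) => Tb' _; apply: upT Tb'.
- by apply/eqP; rewrite -leqn0; case: (specF b0) => _; apply.
case: (specF b) => TF minF; split=> [/minF //| le].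
exact: upT TF.
Qed.

Lemma ideal_of_gcd_exists (K : fieldType) (T : region) a0 b0 : T a0 b0 ->
  exists d, is_gcd (ideal_of K T) d.
Proof.
move=> T0.
pose inT (c : nat * nat) := T c.1 c.2.
have [[a1 b1] [T1 min1]] := @argmin_nat _ inT (fun c => c.1) (a0, b0) T0.
have [[a2 b2] [T2 min2]] := @argmin_nat _ inT (fun c => c.2) (a0, b0) T0.
exists (xy a1 b2); split=> [m /ideal_of_mon Tm | e dvd].
  by apply/mon_leP; rewrite xy_vx xy_vy; split;
    [apply: (min1 (_, _) Tm) | apply: (min2 (_, _) Tm)].
have /mon_leP[] : (e <= xy a1 b1)%MM by apply: dvd; apply/ideal_of_mon; rewrite xy_vx xy_vy.
have /mon_leP[] : (e <= xy a2 b2)%MM by apply: dvd; apply/ideal_of_mon; rewrite xy_vx xy_vy.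
by rewrite !xy_vx !xy_vy => ????; apply/mon_leP; rewrite xy_vx xy_vy.
Qed.

Lemma ideal_one (K : fieldType) (I : ideal K) :
  is_ideal I -> I 1%R -> principal I.
Proof.
move=> [I0 ID IM] I1; exists 1%R => p; split=> [_ J [_ _ JM] J1 | _].
  by rewrite -[p]mulr1; apply/JM/J1.
by rewrite -[p]mulr1; apply: IM.
Qed.

(** If d = gcd(I) and I = I : d, then I is stable under division by d, so the
degree of a monomial of I of least degree forces d = 1; hence I contains pure
powers of both variables. *)
Lemma anchored_right_of (K : fieldType) (I : ideal K) :
  monomial_ideal I -> anchored I -> ~ principal I ->
  exists F, [/\ antitone F, vanishes F, 0 < F 0 & I = ideal_of K (right_of F)].
Proof.
move=> /monomial_ideal_region[T upT ->] /eq_ideal_eq anc nonp.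
have [a0 [b0 T0]] : exists a b, T a b.
  apply: NNPP => noT; apply: nonp; exists 0%R => p; split=> [Tp J [J0 _ _] _ | I0].
    suff -> : p = 0%R by [].
    apply/eqP; rewrite -msupp_eq0; case eqs: (msupp p) => [//|m s].
    by case: noT; exists (m vx), (m vy); apply: Tp; rewrite eqs mem_head.
  apply: I0; first exact: ideal_of_is_ideal.
  by move=> q -> m; rewrite msupp0.
have [d gcdd] := ideal_of_gcd_exists K T0.
move: anc; rewrite /anchor (gcd_idealE gcdd) colon_region => /ideal_of_inj ancT.
have d0 : d = 0%MM.
  have no n : forall a b, T a b -> a + b < n -> d = 0%MM.
    elim: n => // n IHn a b Tab lt.
    have /mon_leP : (d <= xy a b)%MM.
      by case: gcdd => dvd _; apply: dvd; apply/ideal_of_mon; rewrite xy_vx xy_vy.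
    rewrite xy_vx xy_vy => -[lex ley].
    case: (posnP (d vx + d vy)) => [dz | dpos].
      by apply: mon_ext; rewrite mnm0E; lia.
    apply: (IHn (a - d vx) (b - d vy)); last by lia.
    by rewrite ancT !subnK.
  exact: no T0 (ltnSn _).
have dvd0 e : mon_dvd_all (ideal_of K T) e -> e = 0%MM.
  move=> de; case: gcdd => _ /(_ _ de) /mon_leP; rewrite d0 !mnm0E => -[e1 e2].
  by apply: mon_ext; rewrite mnm0E; lia.
have [a Ta] : exists a, T a 0.
  apply: NNPP => no; have : (xy 0 1 : mon) <> 0%MM.
    by move=> e; have := xy_vy 0 1; rewrite e mnm0E.
  apply; apply: dvd0 => m /ideal_of_mon Tm; apply/mon_leP; rewrite xy_vx xy_vy; split=> //.
  rewrite lt0n; apply/eqP => my; by apply: no; exists (m vx); move: Tm; rewrite my.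
have [b Tb] : exists b, T 0 b.
  apply: NNPP => no; have : (xy 1 0 : mon) <> 0%MM.
    by move=> e; have := xy_vx 1 0; rewrite e mnm0E.
  apply; apply: dvd0 => m /ideal_of_mon Tm; apply/mon_leP; rewrite xy_vx xy_vy; split=> //.
  rewrite lt0n; apply/eqP => mx; by apply: no; exists (m vy); move: Tm; rewrite mx.
have [F [aF FB eqF]] := upset_right_of upT Ta Tb.
exists F; split=> //; first by exists b.
  rewrite lt0n; apply/eqP => F0; apply: nonp; apply: ideal_one; first exact: ideal_of_is_ideal.
  rewrite -mpolyX0; apply/ideal_of_mon; rewrite !mnm0E; apply/eqF.
  by rewrite /right_of F0.
exact: ideal_of_ext.
Qed.

(** * The profile of a power of two monomials times an ideal *)

(** The profile of (x^u, y^v)^n J when [h] is that of J: passing from n to n + 1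
adds either u to the x-degree or v to the y-degree, whichever gives the smaller
result; see [stairpowP]. *)
Fixpoint stairpow (u v : nat) (h : nat -> nat) (n b : nat) : nat :=
  if n is n'.+1 then
    if v <= b then minn (stairpow u v h n' b + u) (stairpow u v h n' (b - v))
    else stairpow u v h n' b + u
  else h b.

Lemma pair_pow (T : region) (x1 y1 x2 y2 : nat) n :
  (forall a b, T a b <-> (x1 <= a /\ y1 <= b) \/ (x2 <= a /\ y2 <= b)) ->
  forall a b, region_pow T n a b <->
    exists p q, [/\ p + q = n, p * x1 + q * x2 <= a & p * y1 + q * y2 <= b].
Proof.
move=> defT; elim: n => [|n IHn] a b /=.
  by split=> // _; exists 0, 0; split.
split=> [[a1 [b1 [a2 [b2 [/defT T1 /IHn[p [q [pq lea leb]]] -> ->]]]]]|].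
  case: T1 => -[lex ley]; [exists p.+1, q | exists p, q.+1]; split; rewrite ?mulSn; lia.
move=> [[|p] [q [pq lea leb]]].
  case: q pq lea leb => // q pq; rewrite !mulSn => lea leb.
  exists x2, y2, (a - x2), (b - y2); split; try lia; first by apply/defT; right.
  by apply/IHn; exists 0, q; split; lia.
move: lea leb; rewrite !mulSn => lea leb.
exists x1, y1, (a - x1), (b - y1); split; try lia; first by apply/defT; left.
by apply/IHn; exists p, q; split; lia.
Qed.

Section StairPow.
Variables (u v : nat) (h : nat -> nat).
Local Notation F := (stairpow u v h).

Lemma stairpowP n a b : F n b <= a <->
  exists p q, [/\ p + q = n, v * q <= b & u * p + h (b - v * q) <= a].
Proof.
elim: n a b => [|n IHn] a b.
  split=> [le | [[|p] [[|q] []]]] //; last by rewrite !muln0 subn0.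
  by exists 0, 0; split; rewrite ?muln0 ?subn0.
have left : F n b + u <= a <->
    exists p q, [/\ p.+1 + q = n.+1, v * q <= b & u * p.+1 + h (b - v * q) <= a].
  split=> [le | [p [q [pq leb lea]]]].
    have /IHn[p [q [pq leb lea]]] : F n b <= a - u by lia.
    by exists p, q; split=> //; [lia | rewrite mulnS; lia].
  rewrite mulnS in lea.
  have : F n b <= a - u by apply/IHn; exists p, q; split=> //; lia.
  by lia.
have right : v <= b -> F n (b - v) <= a <->
    exists p q, [/\ p + q.+1 = n.+1, v * q.+1 <= b & u * p + h (b - v * q.+1) <= a].
  move=> levb; rewrite IHn; split=> -[p [q [pq leb lea]]]; exists p, q.
    by rewrite mulnS subnDA; split=> //; lia.
  by rewrite mulnS subnDA in lea; rewrite mulnS in leb; split=> //; lia.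
have -> : F n.+1 b <= a <-> F n b + u <= a \/ (v <= b /\ F n (b - v) <= a).
  by rewrite /=; case: (leqP v b) => levb; lia.
split=> [[/left[p [q ?]] | [levb /(right levb)[p [q ?]]]] | [p [q [pq leb lea]]]].
- by exists p.+1, q.
- by exists p, q.+1.
case: p pq lea => [|p] pq lea; last by left; apply/left; exists p, q.
case: q pq leb lea => // q pq leb lea; right.
have levb : v <= b by rewrite mulnS in leb; lia.
by split=> //; apply/right => //; exists 0, q.
Qed.

Lemma stairpow_le n b : F n b <= n * u + h b.
Proof. by elim: n => [|n IHn] /=; [lia | rewrite mulSn; case: ifP; lia]. Qed.

Lemma stairpow_low n b : b < v -> F n b = n * u + h b.
Proof. by move=> ltbv; elim: n => //= n ->; rewrite leqNgt ltbv mulSn /=; lia. Qed.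

(** At height b - v < n v, not all of the n factors are y^v; trading a factor x^u
for y^v raises the product by v and lowers its x-degree by u. *)
Lemma stairpow_left n b : v <= b < n.+1 * v -> F n b + u <= F n (b - v).
Proof.
elim: n b => [|n IHn] b; first by lia.
rewrite 2!mulSn => ltb.
have le1 : F n.+1 b <= F n (b - v) by move: ltb => /= /andP[-> _]; apply: geq_minr.
rewrite [X in _ <= X]/=; case: ifP => lev; last by lia.
by have := IHn (b - v); rewrite mulSn; lia.
Qed.

(** A factor y^v can be traded for x^u, unless the best product uses x^u alone;
the second term of the minimum accounts for that case. *)
Lemma stairpow_right n b : minn (F n b) (n.+1 * u) <= F n (b + v) + u.
Proof.
elim: n b => [|n IHn] b; first by rewrite mul1n /=; lia.
have := IHn b; rewrite 3!mulSn [F n.+1 (b + v)]/= leq_addl addnK.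
by have : F n.+1 b <= F n b + u; [rewrite /=; case: ifP; lia | lia].
Qed.

Lemma stairpowS_left n b : b < n.+1 * v -> F n.+1 b = F n b + u.
Proof.
move=> ltb /=; case: ifP => // lev; have := @stairpow_left n b; rewrite lev ltb.
by move=> /(_ isT); lia.
Qed.

Lemma stairpowD_left n l b : b < n.+1 * v -> F (n + l) b = F n b + l * u.
Proof.
move=> ltb; elim: l => [|l IHl]; first by rewrite !addn0.
rewrite addnS stairpowS_left ?IHl; first by rewrite mulSn; lia.
by rewrite -addSn mulnDl; lia.
Qed.

Lemma corner_left n l b : b < n.+1 * v -> corner (F n) b -> corner (F (n + l)) b.
Proof.
move=> ltb /cornerP db; apply/cornerP => z ltz; rewrite !stairpowD_left //.
  by rewrite ltn_add2r db.
exact: ltn_trans ltb.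
Qed.

Hypothesis ah : antitone h.

Lemma stairpow_antitone n : antitone (F n).
Proof.
elim: n => [|n IHn] //= b b' leb.
have le1 := IHn b b' leb; have le2 : F n (b' - v) <= F n (b - v) by apply: IHn; lia.
by case: (leqP v b); case: (leqP v b'); lia.
Qed.

Hypothesis u_gt0 : 0 < u.

Lemma stairpow_pos Y n b : (forall z, z < Y -> 0 < h z) -> b < Y + n * v -> 0 < F n b.
Proof.
move=> hpos; elim: n b => [|n IHn] b; first by rewrite addn0 => /hpos.
rewrite mulSn /= => ltb; case: ifP => lev; last by lia.
by have := IHn (b - v); lia.
Qed.

Variable Y : nat.
Hypotheses (v_gt0 : 0 < v) (hY : h Y = 0).

Lemma stairpow_vanish n : F n (Y + n * v) = 0.
Proof.
apply/eqP; rewrite -leqn0; apply/stairpowP; exists 0, n; split; try lia.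
by rewrite muln0 mulnC addnK hY.
Qed.

Lemma antitone_zero b : Y <= b -> h b = 0.
Proof. by move=> /ah; rewrite hY leqn0 => /eqP. Qed.

Lemma stairpow_le_above n b : Y <= b -> F n b <= n * u.
Proof. by move=> /antitone_zero hb; have := stairpow_le n b; rewrite hb addn0. Qed.

(** This is [stairpow_right], as the x-degrees are at most n u from height Y on. *)
Lemma stairpowS_right n b : Y <= b -> F n.+1 (b + v) = F n b.
Proof.
move=> leY; rewrite /= leq_addl addnK.
by have := stairpow_right n b; have := stairpow_le_above n leY; rewrite mulSn; lia.
Qed.

Lemma stairpowD_right n l b : Y <= b -> F (n + l) (b + l * v) = F n b.
Proof.
move=> leY; elim: l => [|l IHl]; first by rewrite !addn0.
by rewrite mulSnr addnA addnS stairpowS_right //; lia.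
Qed.

Lemma stairpow_middle n l m b : Y <= b -> b < n * v -> m <= l ->
  F (n + l) (b + m * v) = F n b + (l - m) * u.
Proof.
move=> leY ltb leml; rewrite -{1}(subnKC leml) addnA stairpowD_left.
  by rewrite stairpowD_right.
by rewrite mulSn mulnDl; lia.
Qed.

(** When [b = Y], heights below Y matter too; this is why [stairpow_right] covers
all heights. *)
Lemma corner_shift n b : Y <= b -> corner (F n) b -> corner (F n.+1) (b + v).
Proof.
move=> leY /cornerP db; apply/cornerP => z ltz; rewrite stairpowS_right //.
have leb := stairpow_le_above n leY.
case: (leqP v z) => lev; last by rewrite (stairpow_low n.+1) // mulSn; lia.
rewrite /= lev leq_min db ?andbT; last by lia.
have := db (z - v); have := stairpow_right n (z - v); rewrite subnK // mulSn; lia.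
Qed.

Lemma corner_middle n l m b : Y <= b -> b < n * v -> m <= l ->
  corner (F n) b -> corner (F (n + l)) (b + m * v).
Proof.
move=> leY ltb leml db; have d1 : corner (F (n + m)) (b + m * v).
  elim: m {leml} => [|m IHm]; first by rewrite !addn0.
  by rewrite mulSnr addnA addnS; apply: corner_shift => //; lia.
rewrite -(subnKC leml) addnA; apply: corner_left => //.
by rewrite mulSn mulnDl; lia.
Qed.

Section Cut.
Variable r : nat.
Hypothesis rvY : Y <= r * v.
Local Notation n := r.+1.

(** Both kinds of trade are possible between these two heights. *)
Lemma stairpow_period : F n (n * v) + u = F n (r * v).
Proof.
have e1 : n * v - v = r * v by rewrite mulSn addKn.
have e2 : r * v + v = n * v by rewrite mulSn addnC.
have range : v <= n * v < n.+1 * v by rewrite !mulSn; lia.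
have := stairpow_left range; rewrite e1.
have := stairpow_right n (r * v); rewrite e2.
by have := stairpow_le_above n rvY; rewrite (mulSn n); lia.
Qed.

(** Since the profile drops by u > 0 over one period, it has a corner in
]rv, (r+1)v]; a corner at the upper end comes with one at the lower end. *)
Lemma corner_in_period : exists b, [/\ r * v <= b, b < n * v & corner (F n) b].
Proof.
have [z [lez dz eqz _]] := last_corner (n * v) (@stairpow_antitone n).
have period := stairpow_period.
have ltz : r * v < z.
  by rewrite ltnNge; apply/negP => /(stairpow_antitone n); lia.
case: (ltnP z (n * v)) => [|gez]; first by exists z; rewrite ltnW.
exists (r * v); split; rewrite ?mulSn //; first by lia.
apply/cornerP => y lty; have eqzn : z = n * v by lia.
have range : v <= y + v < n.+1 * v by rewrite !mulSn; lia.
have := stairpow_left range; rewrite addnK.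
have : F n z < F n (y + v) by apply: (cornerP _ _ dz); rewrite eqzn mulSn; lia.
by rewrite eqzn; lia.
Qed.

(** The y-degree of the generator at which the segments are separated. *)
Definition is_cut b : Prop :=
  [/\ r * v <= b, b < n * v, corner (F n) b &
      forall z, r * v <= z -> corner (F n) z -> b <= z].

Lemma cut_exists : exists b, is_cut b.
Proof.
have [b0 [leb ltb db]] := corner_in_period.
have [|b /andP[leb1 db1] minb] := @ex_minnP (fun b => (r * v <= b) && corner (F n) b).
  by exists b0; rewrite leb db.
exists b; split=> // [|z lez dz]; last by rewrite minb // lez dz.
by apply: leq_ltn_trans ltb; rewrite minb // leb db.
Qed.

Section AtCut.
Variable b : nat.
Hypothesis cb : is_cut b.

Lemma cut_shift : F n (b + v) + u = F n b.
Proof.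
have [leb ltb _ _] := cb.
have range : v <= b + v < n.+1 * v by rewrite mulSn; lia.
have := stairpow_left range; rewrite addnK.
have := stairpow_right n b; have := stairpow_le_above n (leq_trans rvY leb).
by rewrite (mulSn n); lia.
Qed.

(** Corners repeat with period v, so a corner here would yield one between r v
and the cut. *)
Lemma cut_corner_next z : n * v <= z -> z < b + v -> ~~ corner (F n) z.
Proof.
have [leb ltb _ minb] := cb => lez ltz; apply/negP => /cornerP dz.
suff /(minb (z - v)) : corner (F n) (z - v) by rewrite mulSn in lez; lia.
apply/cornerP => y lty; rewrite mulSn in lez.
have range : v <= y + v < n.+1 * v by rewrite !mulSn in ltb *; lia.
have := stairpow_left range; rewrite addnK.
have : F n z < F n (y + v) by apply: dz; lia.
have := stairpow_right n (z - v); rewrite subnK; last by lia.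
have leY : Y <= z - v by lia.
by have := stairpow_le_above n leY; rewrite (mulSn n); lia.
Qed.

End AtCut.
End Cut.
End StairPow.

(** * The segments *)

Section Segments.
Variables (K : fieldType) (u v : nat) (h : nat -> nat) (Y r : nat).
Hypotheses (u_gt0 : 0 < u) (v_gt0 : 0 < v).
Hypotheses (ah : antitone h) (hY : h Y = 0) (rvY : Y <= r * v).
Local Notation n := r.+1.
Local Notation F := (stairpow u v h n).
Local Notation J := (ideal_of K (right_of h)).

(** This ideal is the Q of the definition of the segments. *)
Lemma pair_pow_mul :
  ideal_mul (ideal_pow (mon_gens K [:: xy u 0; xy 0 v]) n) J = ideal_of K (right_of F).
Proof.
rewrite /mon_gens mon_gen_region ideal_pow_region ideal_mul_region; last exact: right_of_upset.
apply: ideal_of_ext => a b; rewrite /right_of stairpowP //.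
have defT a' b' : up (fun m => m \in [:: xy u 0; xy 0 v]) a' b' <->
    (u <= a' /\ 0 <= b') \/ (0 <= a' /\ v <= b').
  split=> [[m] | [] [lea leb]].
  - by rewrite !inE => /orP[] /eqP ->; rewrite xy_vx xy_vy; [left | right].
  - by exists (xy u 0); rewrite ?inE ?eqxx // xy_vx xy_vy.
  by exists (xy 0 v); rewrite ?inE ?eqxx ?orbT // xy_vx xy_vy.
split=> [[a1 [b1 [a2 [b2 [/(pair_pow n defT)[p [q [pq lea leb]]] h2 -> ->]]]]] |].
  exists p, q; split=> //; first by lia.
  have : h (b1 + b2 - v * q) <= h b2 by apply: ah; lia.
  by rewrite /right_of in h2; lia.
move=> [p [q [pq leb lea]]].
exists (u * p), (v * q), (a - u * p), (b - v * q); split; try lia.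
  by apply/(pair_pow n defT); exists p, q; split=> //; lia.
Qed.

Let aF : antitone F := @stairpow_antitone u v h ah n.
Let vF : vanishes F := ex_intro _ _ (stairpow_vanish u_gt0 v_gt0 hY n).

Lemma mem_seg_gens m :
  (m \in seg_gens u v r J) = (m vx == F (m vy)) && corner F (m vy).
Proof. by rewrite /seg_gens pair_pow_mul; case: (mingens_right_of K aF vF). Qed.

Variable b : nat.
Hypothesis cb : is_cut u v h r b.

Lemma seg_gE : seg_g u v r J = xy (F b) b.
Proof.
have [leb ltb db minb] := cb.
have gL : xy (F b) b \in seg_L u v r J.
  by rewrite mem_filter xy_vy leb mem_seg_gens xy_vx xy_vy eqxx.
rewrite /seg_g; set leY := (fun f g : mon => f vy <= g vy).
have trY : transitive leY by move=> x y z; apply: leq_trans.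
have totY : total leY by move=> x y; apply: leq_total.
have := sort_sorted totY (seg_L u v r J).
have := mem_sort leY (seg_L u v r J).
case: (sort _ _) => [|g s] memL /=; first by move: gL; rewrite -memL.
rewrite (path_sortedE trY) => /andP[/allP minL _].
have : g \in seg_L u v r J by rewrite -memL mem_head.
rewrite mem_filter mem_seg_gens => /andP[leg /andP[/eqP gx dg]].
have gy : g vy = b.
  apply/eqP; rewrite eqn_leq minb // andbT.
  move: gL; rewrite -memL in_cons => /orP[/eqP <-|/minL]; first by rewrite xy_vy.
  by rewrite /leY xy_vy.
by apply: mon_ext; rewrite ?xy_vx ?xy_vy // gx gy.
Qed.

(** The cut is a corner, so every point of the graph above it lies above a
generator in L. *)
Lemma seg_AE : seg_A u v r J = ideal_of K (right_of (fun y => F (b + y))).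
Proof.
have [leb ltb db minb] := cb.
rewrite /seg_A seg_gE xy_vy /mon_gens mon_gen_region colon_region; apply: ideal_of_ext => x y.
rewrite xy_vx xy_vy addn0 [y + b]addnC; split=> [[m] | le].
  rewrite mem_filter mem_seg_gens => /andP[_ /andP[/eqP mx _]] [lex ley].
  by apply: leq_trans lex; rewrite mx; apply: aF.
have [z [lez dz eqz maxz]] := last_corner (b + y) aF.
exists (xy (F z) z); last by rewrite xy_vx xy_vy eqz.
rewrite mem_filter mem_seg_gens xy_vx xy_vy eqxx dz andbT /=.
by rewrite (leq_trans leb) // maxz // leq_addr.
Qed.

(** There is no corner between the height r v and the cut, so R and g describe the
graph up to the cut. *)
Lemma seg_BE : seg_B u v r J = ideal_of K (right_of (fun y => F (minn y b) - F b)).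
Proof.
have [leb ltb db minb] := cb.
rewrite /seg_B seg_gE xy_vx /mon_gens mon_gen_region colon_region; apply: ideal_of_ext => x y.
rewrite xy_vx xy_vy addn0 /right_of leq_subLR [F b + x]addnC; split=> [[m] | le].
  rewrite in_cons mem_filter mem_seg_gens => /orP[/eqP -> |].
    by rewrite xy_vx xy_vy => -[lex ley]; rewrite (minn_idPr ley).
  move=> /andP[ltm /andP[/eqP mx _]] [lex ley].
  apply: leq_trans lex; rewrite mx; apply: aF.
  by rewrite leq_min ley ltnW // (leq_trans ltm).
case: (leqP b y) => leby.
  exists (xy (F b) b); first by rewrite mem_head.
  by rewrite xy_vx xy_vy leq_addl.
rewrite (minn_idPl (ltnW leby)) in le.
have [z [lez dz eqz _]] := last_corner y aF.
exists (xy (F z) z); last by rewrite xy_vx xy_vy eqz.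
rewrite in_cons mem_filter mem_seg_gens xy_vx xy_vy eqxx dz !andbT; apply/orP; right.
by rewrite ltnNge; apply/negP => /minb /(_ dz); lia.
Qed.

(** One period of the profile, starting at the cut. Its generators are listed for
heights up to (r+1) v only, but the next corner is the translate of the cut
([cut_corner_next]), so the added generator x^(alpha-u) y^(beta+v) completes
the period. *)
Lemma seg_HE : seg_H u v r J =
  ideal_of K (right_of (fun y => F (b + minn y v) - (F b - u))).
Proof.
have [leb ltb db minb] := cb.
have shift := cut_shift ah u_gt0 v_gt0 hY rvY cb.
have eqs : F b - u = F (b + v) by lia.
rewrite /seg_H seg_gE !xy_vx !xy_vy eqs /mon_gens mon_gen_region colon_region.
apply: ideal_of_ext => x y; rewrite xy_vx xy_vy /right_of leq_subLR [_ + x]addnC.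
split=> [[m] | le].
  rewrite in_cons mem_filter mem_seg_gens => /orP[/eqP -> |].
    rewrite xy_vx xy_vy => -[lex ley].
    by rewrite (minn_idPr _) //; lia.
  move=> /andP[ltm /andP[/eqP mx _]] [lex ley].
  apply: leq_trans lex; rewrite mx; apply: aF.
  by move: ltm; rewrite mulSn; lia.
case: (leqP v y) => levy.
  exists (xy (F (b + v)) (b + v)); first by rewrite mem_head.
  by rewrite xy_vx xy_vy; lia.
rewrite (minn_idPl (ltnW levy)) in le.
have [z [lez dz eqz maxz]] := last_corner (b + y) aF.
exists (xy (F z) z); last by rewrite xy_vx xy_vy eqz; lia.
have lebz : b <= z by apply: maxz => //; lia.
rewrite in_cons mem_filter mem_seg_gens xy_vx xy_vy eqxx dz !andbT; apply/orP; right.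
rewrite (leq_trans leb) //= ltnNge; apply/negP => lez'.
suff : ~~ corner F z by rewrite dz.
by apply: (cut_corner_next ah u_gt0 v_gt0 hY rvY cb lez'); lia.
Qed.

End Segments.

(** * Links as concatenation of profiles *)

Definition staircase_above (K : fieldType) (Phi : nat -> nat) (t : nat) : ideal K :=
  ideal_of K (right_of (fun y => Phi (t + y))).
Arguments staircase_above K Phi t _ : clear implicits.

(** The part between the heights [t] and [t + d], with the origin moved so that
both axes are met. *)
Definition staircase_slice (K : fieldType) (Phi : nat -> nat) (t d : nat) : ideal K :=
  ideal_of K (right_of (fun y => Phi (t + minn y d) - Phi (t + d))).
Arguments staircase_slice K Phi t d _ : clear implicits.

(** A link places the first ideal on top of the second one, to its left. The
corner at [t + d] makes the slice have height exactly [d], so that the vertical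
shift of the link is the right one. *)
Lemma link_slice (K : fieldType) (Phi : nat -> nat) t d :
  antitone Phi -> vanishes Phi -> corner Phi (t + d) ->
  link (staircase_above K Phi (t + d)) (staircase_slice K Phi t d) = staircase_above K Phi t.
Proof.
move=> aPhi vPhi cPhi.
have aC s : antitone (fun y => Phi (s + y)) by move=> y z le; apply: aPhi; lia.
have vC s : vanishes (fun y => Phi (s + y)).
  by case: vPhi => B PB; exists B; apply/eqP; rewrite -leqn0 -PB; apply: aPhi; lia.
set Z := fun y => Phi (t + minn y d) - Phi (t + d).
have aZ : antitone Z by move=> y z le; apply: leq_sub2r; apply: aPhi; lia.
have Zd : Z d = 0 by rewrite /Z minnn subnn.
have vZ : vanishes Z by exists d.
have cZ : corner Z d.
  apply/cornerP => z ltz; rewrite Zd subn_gt0.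
  by apply: (cornerP _ _ cPhi); lia.
rewrite /link /staircase_slice /staircase_above -/Z !anchor_right_of //.
rewrite (dist_vy_right_of K aZ Zd cZ) dist_vx_right_of // addn0 !scale_region; try exact: right_of_upset.
rewrite ideal_add_region; try by apply: shift_upset; apply: right_of_upset.
apply: ideal_of_ext => a b; rewrite !xy_vx !xy_vy /right_of /Z !subn0.
case: (leqP d b) => [le | lt].
  have -> : t + d + (b - d) = t + b by lia.
  have : Phi (t + b) <= Phi (t + d) by apply: aPhi; lia.
  by split=> [[[]|[]]|]; [| lia | left].
have : Phi (t + d) <= Phi (t + b) by apply: aPhi; lia.
by split=> [[[]|[]]|]; [lia | lia | right; split; lia].
Qed.

Lemma chain_lt (f : nat -> nat) k : (forall i, 0 < i <= k -> f i < f i.+1) ->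
  forall i j, 0 < i -> i < j -> j <= k.+1 -> f i < f j.
Proof.
move=> f_incr i j i0 /subnKC <-; elim: (j - i.+1) => [|e IHe] le.
  by rewrite addn0 f_incr //; lia.
by apply: ltn_trans (IHe _) _; [lia | rewrite addnS; apply: f_incr; lia].
Qed.

Lemma chain_gt (f : nat -> nat) k : (forall i, 0 < i <= k -> f i.+1 < f i) ->
  forall i j, 0 < i -> i < j -> j <= k.+1 -> f j < f i.
Proof.
move=> f_decr i j i0 /subnKC <-; elim: (j - i.+1) => [|e IHe] le.
  by rewrite addn0 f_decr //; lia.
by apply: ltn_trans (IHe _); [rewrite addnS; apply: f_decr; lia | lia].
Qed.

Section Chain.
Variables (K : fieldType) (k : nat) (xs ys : nat -> nat) (h : nat -> nat).
Variables (Y r l : nat).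
Hypothesis k_gt0 : 0 < k.
Hypothesis xs_incr : forall i, 0 < i <= k -> xs i < xs i.+1.
Hypothesis ys_decr : forall i, 0 < i <= k -> ys i.+1 < ys i.
Hypotheses (xs1 : xs 1 = 0) (ysk : ys k.+1 = 0).
Hypotheses (ah : antitone h) (hY : h Y = 0) (hpos : forall z, z < Y -> 0 < h z).
Let u i := xs i.+1 - xs i.
Let v i := ys i - ys i.+1.
Hypothesis rvY : forall i, 0 < i <= k -> Y <= r * v i.
Local Notation n := r.+1.
Local Notation N := (n + l).
Local Notation S i := (stairpow (u i) (v i) h).
Variable beta : nat -> nat.
Hypothesis cut : forall i, 0 < i <= k -> is_cut (u i) (v i) h r (beta i).
Variable Phi : nat -> nat.
Hypotheses (aPhi : antitone Phi) (vPhi : vanishes Phi).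
Hypothesis PhiP : forall a b, Phi b <= a <->
  exists i, [/\ 0 < i <= k, N * ys i.+1 <= b & N * xs i + S i N (b - N * ys i.+1) <= a].

Let alpha i := S i n (beta i).
Let T i m := N * ys i.+1 + (beta i + m * v i).

Lemma width_gt0 i : 0 < i <= k -> 0 < u i.
Proof. by move=> /xs_incr; rewrite /u; lia. Qed.

Lemma height_gt0 i : 0 < i <= k -> 0 < v i.
Proof. by move=> /ys_decr; rewrite /v; lia. Qed.

Lemma xs_mono i j : 0 < i -> i <= j -> j <= k.+1 -> xs i <= xs j.
Proof.
move=> i0; rewrite leq_eqVlt => /orP[/eqP -> //|lt] le.
exact/ltnW/(chain_lt xs_incr).
Qed.

Lemma ys_mono i j : 0 < i -> i <= j -> j <= k.+1 -> ys j <= ys i.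
Proof.
move=> i0; rewrite leq_eqVlt => /orP[/eqP -> //|lt] le.
exact/ltnW/(chain_gt ys_decr).
Qed.

Lemma NxsS i : 0 < i <= k -> N * xs i.+1 = N * xs i + N * u i.
Proof. by move=> /xs_incr lt; rewrite -mulnDr /u subnKC // ltnW. Qed.

Lemma NysS i : 0 < i <= k -> N * ys i = N * ys i.+1 + N * v i.
Proof. by move=> /ys_decr lt; rewrite -mulnDr /v subnKC // ltnW. Qed.

Lemma beta_ge i : 0 < i <= k -> Y <= beta i.
Proof. by move=> ik; case: (cut ik) => le _ _ _; apply: leq_trans (rvY ik) le. Qed.

Lemma beta_lt i : 0 < i <= k -> beta i < n * v i.
Proof. by move=> ik; case: (cut ik). Qed.

Lemma stairpow_cut i m : 0 < i <= k -> m <= l ->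
  S i N (beta i + m * v i) = alpha i + (l - m) * u i.
Proof.
move=> ik le.
exact: (stairpow_middle ah (width_gt0 ik) (height_gt0 ik) hY (beta_ge ik) (beta_lt ik) le).
Qed.

Lemma alpha_le i : 0 < i <= k -> alpha i <= n * u i.
Proof. by move=> ik; apply: stairpow_le_above hY _ _ (beta_ge ik). Qed.

Lemma cut_corner i m : 0 < i <= k -> m <= l -> corner (S i N) (beta i + m * v i).
Proof.
move=> ik le; have [_ _ cb _] := cut ik.
exact: (corner_middle ah (width_gt0 ik) (height_gt0 ik) hY (beta_ge ik) (beta_lt ik) le cb).
Qed.

(** Above its cut the i-th summand is at most N x_(i+1), where all later summands
start, and earlier summands live above height N y_i only. *)
Lemma Phi_region i z : 0 < i <= k -> beta i <= z -> z < N * v i \/ i = 1 ->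
  Phi (N * ys i.+1 + z) = N * xs i + S i N z.
Proof.
move=> ik lez ltz; apply/eqP; rewrite eqn_leq; apply/andP; split.
  by apply/PhiP; exists i; rewrite ik leq_addr addKn.
have [j [jk ley lex]] : exists j, [/\ 0 < j <= k, N * ys j.+1 <= N * ys i.+1 + z &
    N * xs j + S j N (N * ys i.+1 + z - N * ys j.+1) <= Phi (N * ys i.+1 + z)].
  exact/PhiP.
apply: leq_trans lex; case: (ltngtP j i) => [lt | gt | ->]; last by rewrite addKn.
  have := leq_mul (leqnn N) (@ys_mono j.+1 i isT lt ltac:(lia)).
  by have := NysS ik; lia.
have := leq_mul (leqnn N) (@xs_mono i.+1 j isT gt ltac:(lia)).
have : S i N z <= S i N (beta i) by apply: stairpow_antitone.
have := @stairpow_cut i 0 ik (leq0n _); rewrite mul0n addn0 subn0 => ->.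
have := alpha_le ik; have := NxsS ik; rewrite mulnDl; lia.
Qed.

Lemma Phi_cut i m : 0 < i <= k -> m <= l ->
  Phi (T i m) = N * xs i + alpha i + (l - m) * u i.
Proof.
move=> ik le; rewrite Phi_region //; first by rewrite stairpow_cut // addnA.
  exact: leq_addr.
by left; have := beta_lt ik; rewrite mulnDl; have := leq_mul le (leqnn (v i)); lia.
Qed.

(** The i-th summand has a corner at these heights. It could be hidden only by a
later summand, which starts at N x_(i+1): the two x-degrees can agree only if
the height is at most N y_(i+1) + Y, and there the next summand has not yet
reached its least x-degree. *)
Lemma Phi_corner i m : 0 < i <= k -> m <= l -> corner Phi (T i m).
Proof.
move=> ik le; apply/cornerP => z ltz; rewrite ltnNge; apply/negP => /PhiP[j [jk ley]].
apply/negP; rewrite -ltnNge.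
have cb := cut_corner ik le; have eqb := stairpow_cut ik le.
have ltb : beta i + m * v i < N * v i.
  by have := beta_lt ik; rewrite mulnDl; have := leq_mul le (leqnn (v i)); lia.
have ltNb : S i N (beta i + m * v i) <= N * u i.
  by have := alpha_le ik; rewrite eqb mulnDl; have := leq_mul (leq_subr m l) (leqnn (u i)); lia.
rewrite Phi_cut // -addnA -eqb.
case: (ltngtP j i) => [lt | gt | eqji].
- have := leq_mul (leqnn N) (@ys_mono j.+1 i isT lt ltac:(lia)).
  by have := NysS ik; rewrite /T in ltz; lia.
- have lex := leq_mul (leqnn N) (@xs_mono i.+1 j isT gt ltac:(lia)).
  case: (ltnP (S i N (beta i + m * v i)) (N * u i)) => [|geN]; first by have := NxsS ik; lia.
  case: (ltngtP j i.+1) => [|gt'|eqj]; first by lia.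
    have ik' : 0 < i.+1 <= k by lia.
    have := leq_mul (leqnn N) (@xs_mono i.+2 j isT gt' ltac:(lia)).
    have := NxsS ik; have := NxsS ik'; have := leq_mul (leq_addr l n) (width_gt0 ik'); lia.
  (* Here both x-degrees are N x_(i+1). *)
  suff : 0 < S j N (z - N * ys j.+1) by have := NxsS ik; lia.
  apply: (stairpow_pos (width_gt0 jk) hpos).
  have leY : beta i + m * v i <= Y.
    rewrite leqNgt; apply/negP => /(cornerP _ _ cb).
    have := @stairpow_le_above (u i) (v i) h ah Y hY N Y (leqnn _); lia.
  by have := NysS jk; rewrite /T -eqj in ltz *; lia.
by rewrite eqji in ley *; rewrite ltn_add2l; apply: (cornerP _ _ cb); rewrite /T in ltz; lia.
Qed.

(** The summands i and i+1 are the only ones that matter from the cut of the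
(i+1)-st one up to the cut of the i-th one. *)
Lemma Phi_between i z a : 0 < i -> i < k ->
  beta i.+1 <= z -> z < N * v i.+1 + beta i ->
  Phi (N * ys i.+2 + z) <= a <->
  (N * v i.+1 <= z /\ N * xs i + S i N (z - N * v i.+1) <= a) \/
  N * xs i.+1 + S i.+1 N z <= a.
Proof.
move=> i0 ltk lez ltz; have ik : 0 < i <= k by lia.
have ik' : 0 < i.+1 <= k by lia.
have eqy := NysS ik'; have eqyi := NysS ik; have eqx := NxsS ik'.
rewrite PhiP; split=> [[j [jk ley lex]] | [[le lex] | lex]]; first last.
- by exists i.+1; rewrite ik' leq_addr addKn.
- exists i; split=> //; first by lia.
  by rewrite eqy subnDl.
case: (ltnP j i) => [lt | ge].
  have := leq_mul (leqnn N) (@ys_mono j.+1 i isT lt ltac:(lia)).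
  have := beta_lt ik; have := mulnDl n l (v i); lia.
case: (ltngtP j i) => [|gt|eqj]; [by lia | | ]; last first.
  by rewrite eqj in ley lex; left; rewrite eqy subnDl in lex; split=> //; lia.
right; case: (ltngtP j i.+1) => [|gt'|eqj]; [by lia | | by rewrite eqj addKn in lex].
have := leq_mul (leqnn N) (@xs_mono i.+2 j isT gt' ltac:(lia)).
have : S i.+1 N z <= S i.+1 N (beta i.+1) by apply: stairpow_antitone.
have := @stairpow_cut i.+1 0 ik' (leq0n _); rewrite mul0n addn0 subn0 => ->.
have := alpha_le ik'; have := mulnDl n l (u i.+1); lia.
Qed.

Local Notation J := (ideal_of K (right_of h)).

Lemma link_first : seg_A (u 1) (v 1) r J = staircase_above K Phi (T 1 l).
Proof.
have ik : 0 < 1 <= k by [].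
rewrite (seg_AE K (width_gt0 ik) (height_gt0 ik) ah hY (rvY ik) (cut ik)).
apply: ideal_of_ext => a b; rewrite /right_of.
suff -> : Phi (T 1 l + b) = S 1 n (beta 1 + b) by [].
have -> : T 1 l + b = N * ys 2 + (beta 1 + b + l * v 1) by rewrite /T; lia.
rewrite Phi_region //; [|by lia|by right].
rewrite xs1 muln0 (stairpowD_right ah (width_gt0 ik) (height_gt0 ik) hY) //.
by have := beta_ge ik; lia.
Qed.

(** On the periodic stretch Phi is a translate of the profile of Q, one period at
a time. *)
Lemma link_H i m : 0 < i <= k -> m < l ->
  link (staircase_above K Phi (T i m.+1)) (seg_H (u i) (v i) r J) = staircase_above K Phi (T i m).
Proof.
move=> ik lt; rewrite (seg_HE K (width_gt0 ik) (height_gt0 ik) ah hY (rvY ik) (cut ik)).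
have eqT : T i m.+1 = T i m + v i by rewrite /T mulSn; lia.
suff -> : ideal_of K (right_of (fun y => S i n (beta i + minn y (v i)) - (S i n (beta i) - u i))) =
    staircase_slice K Phi (T i m) (v i).
  by rewrite eqT; apply: link_slice; rewrite // -eqT; apply: Phi_corner.
apply: ideal_of_ext => a b; rewrite /right_of -eqT.
suff -> : Phi (T i m + minn b (v i)) - Phi (T i m.+1) =
  S i n (beta i + minn b (v i)) - (S i n (beta i) - u i) by [].
rewrite Phi_cut //; set z := minn b (v i).
have lez : z <= v i by rewrite geq_minr.
have -> : T i m + z = N * ys i.+1 + (beta i + z + m * v i) by rewrite /T; lia.
have bl := beta_lt ik; have bg := beta_ge ik.
have ltN : (n + m).+1 * v i <= N * v i by rewrite leq_mul2r; lia.
have lt1 : beta i + z + m * v i < (n + m).+1 * v i by rewrite mulSn mulnDl; lia.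
rewrite Phi_region //; [|by lia|by left; lia].
have -> : N = n + m + (l - m) by lia.
rewrite (stairpowD_left _ _ _ lt1).
rewrite (stairpowD_right ah (width_gt0 ik) (height_gt0 ik) hY); last by lia.
have shift := cut_shift ah (width_gt0 ik) (height_gt0 ik) hY (rvY ik) (cut ik).
have -> : (l - m) * u i = (l - m.+1) * u i + u i by rewrite -mulSnr; congr (_ * _); lia.
rewrite -/(alpha i) in shift *; lia.
Qed.

Lemma dist_seg_B i : 0 < i <= k -> dist vy (seg_B (u i) (v i) r J) = beta i.
Proof.
move=> ik; rewrite (seg_BE K (width_gt0 ik) (height_gt0 ik) ah hY (rvY ik) (cut ik)).
have [_ _ /cornerP cb _] := cut ik.
apply: dist_vy_right_of; first by move=> y z le; apply/leq_sub2r/stairpow_antitone => //; lia.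
  by rewrite minnn subnn.
by apply/cornerP => z lt; rewrite minnn subnn subn_gt0; apply: cb; lia.
Qed.

Lemma dist_seg_A i : 0 < i <= k -> dist vx (seg_A (u i) (v i) r J) = alpha i.
Proof.
move=> ik; rewrite (seg_AE K (width_gt0 ik) (height_gt0 ik) ah hY (rvY ik) (cut ik)).
rewrite dist_vx_right_of ?addn0 //; first by move=> y z le; apply: stairpow_antitone => //; lia.
exists (Y + n * v i); apply/eqP; rewrite -leqn0.
rewrite -(stairpow_vanish (width_gt0 ik) (height_gt0 ik) hY n).
by apply: stairpow_antitone => //; lia.
Qed.

(** In the coordinates of C_i, the ideals B_i and A_(i+1) are placed as the
summands i and i+1 are around the point N g_(i+1); what [Phi_between] says is
that their overlay is the graph of Phi. *)
Lemma link_C i : 0 < i -> i < k ->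
  link (staircase_above K Phi (T i 0))
    (ideal_add
      (ideal_scale (seg_B (u i) (v i) r J)
        (xy 0 (n * v i.+1 - dist vy (seg_B (u i.+1) (v i.+1) r J))))
      (ideal_scale (seg_A (u i.+1) (v i.+1) r J)
        (xy (n * u i - dist vx (seg_A (u i) (v i) r J)) 0))) =
  staircase_above K Phi (T i.+1 l).
Proof.
move=> i0 ltk; have ik : 0 < i <= k by lia.
have ik' : 0 < i.+1 <= k by lia.
rewrite dist_seg_B // dist_seg_A //.
rewrite (seg_BE K (width_gt0 ik) (height_gt0 ik) ah hY (rvY ik) (cut ik)).
rewrite (seg_AE K (width_gt0 ik') (height_gt0 ik') ah hY (rvY ik') (cut ik')).
have bl := beta_lt ik; have bl' := beta_lt ik'; have bg' := beta_ge ik'.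
pose d := n * v i.+1 - beta i.+1 + beta i.
have eqNv : N * v i.+1 = n * v i.+1 + l * v i.+1 by rewrite mulnDl.
have eqNvi : N * v i = n * v i + l * v i by rewrite mulnDl.
have eqNu : N * u i = n * u i + l * u i by rewrite mulnDl.
have eqT : T i 0 = T i.+1 l + d.
  by rewrite /T /d (NysS ik') eqNv; lia.
have link_slice_C Z : Z = staircase_slice K Phi (T i.+1 l) d ->
    link (staircase_above K Phi (T i 0)) Z = staircase_above K Phi (T i.+1 l).
  by move=> ->; rewrite eqT; apply: link_slice; rewrite // -eqT; apply: Phi_corner.
apply: link_slice_C.
have aB : antitone (fun y => S i n (minn y (beta i)) - S i n (beta i)).
  by move=> y z le; apply/leq_sub2r/stairpow_antitone => //; lia.
have aA : antitone (fun y => S i.+1 n (beta i.+1 + y)).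
  by move=> y z le; apply: stairpow_antitone => //; lia.
rewrite !scale_region; try exact: right_of_upset.
rewrite ideal_add_region; try by apply: shift_upset; apply: right_of_upset.
apply: ideal_of_ext => a b; rewrite !xy_vx !xy_vy /right_of !subn0 -eqT -/(alpha i).
case: (leqP d b) => [le | lt].
  rewrite -eqT subnn; split=> // _; left; split; rewrite // /d in le *; first by lia.
  by rewrite (minn_idPr _) ?subnn //; lia.
rewrite [X in _ <-> is_true X]leq_subLR [Phi (T i 0) + a]addnC.
have -> : T i.+1 l + b = N * ys i.+2 + (beta i.+1 + b + l * v i.+1) by rewrite /T; lia.
rewrite Phi_between //; [|by lia|by rewrite /d in lt; lia].
rewrite Phi_cut // subn0 (stairpowD_right ah (width_gt0 ik') (height_gt0 ik') hY); last by lia.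
have al := alpha_le ik; have eqx := NxsS ik.
have -> : N * v i.+1 <= beta i.+1 + b + l * v i.+1 <-> n * v i.+1 - beta i.+1 <= b.
  by lia.
have -> : beta i.+1 + b + l * v i.+1 - N * v i.+1 = b - (n * v i.+1 - beta i.+1) by lia.
set z := b - _; have ltz : z <= beta i by rewrite /d in lt; lia.
rewrite (minn_idPl ltz) stairpowD_left; last by rewrite mulSn; lia.
split=> [[[_ le1 le2] | [le1 _ le2]] | [[le1 le2] | le1]].
- by left; split; lia.
- by right; lia.
- by left; split; lia.
by right; split; lia.
Qed.

Lemma link_last :
  link (staircase_above K Phi (T k 0)) (seg_B (u k) (v k) r J) = staircase_above K Phi 0.
Proof.
have ik : 0 < k <= k by lia.
rewrite (seg_BE K (width_gt0 ik) (height_gt0 ik) ah hY (rvY ik) (cut ik)).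
have eqT : T k 0 = 0 + beta k by rewrite /T ysk; lia.
suff -> : ideal_of K (right_of (fun y => S k n (minn y (beta k)) - S k n (beta k))) =
    staircase_slice K Phi 0 (beta k).
  by rewrite eqT; apply: link_slice; rewrite // -eqT; apply: Phi_corner.
apply: ideal_of_ext => a b; rewrite /right_of -eqT add0n.
rewrite !leq_subLR Phi_cut // subn0.
set z := minn b (beta k); have lez : z <= beta k by rewrite geq_minr.
have bl := beta_lt ik; have al := alpha_le ik.
rewrite PhiP -/(alpha k).
have eqS : S k N z = S k n z + l * u k by rewrite stairpowD_left // mulSn; lia.
split=> [le | [j [jk ley lex]]].
  by exists k; rewrite ik ysk muln0 subn0 eqS; split=> //; lia.
case: (ltnP j k) => [lt | ge]; last first.
  have eqj : j = k by lia.
  by rewrite eqj ysk muln0 subn0 eqS in lex; lia.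
have := leq_mul (leqnn N) (@ys_mono j.+1 k isT lt ltac:(lia)).
by have := NysS ik; have := mulnDl n l (v k); lia.
Qed.

End Chain.

(** * Decomposing powers *)

Definition degsum (c : 'I_2) (w : seq mon) : nat := \sum_(m <- w) m c.

Lemma degsum_cat c w1 w2 : degsum c (w1 ++ w2) = degsum c w1 + degsum c w2.
Proof. exact: big_cat. Qed.

Lemma degsum_cons c m w : degsum c (m :: w) = m c + degsum c w.
Proof. exact: big_cons. Qed.

Lemma degsum_perm c w1 w2 : perm_eq w1 w2 -> degsum c w1 = degsum c w2.
Proof. by move=> eqw; apply: perm_big. Qed.

Lemma sum_nseq (f : mon -> nat) n m : \sum_(x <- nseq n m) f x = n * f m.
Proof. by elim: n => [|n IHn]; rewrite ?big_nil // big_cons IHn mulSn. Qed.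

Lemma degsum_nseq c n m : degsum c (nseq n m) = n * m c.
Proof. exact: sum_nseq. Qed.

Lemma region_powD T n1 n2 a1 b1 a2 b2 : upset T ->
  region_pow T n1 a1 b1 -> region_pow T n2 a2 b2 ->
  region_pow T (n1 + n2) (a1 + a2) (b1 + b2).
Proof.
move=> upT; elim: n1 a1 b1 => [|n1 IHn] a1 b1 /=.
  by move=> _; apply: region_pow_upset; rewrite leq_addl.
move=> [a [b [a' [b' [Tab pw -> ->]]]]] pw2.
by exists a, b, (a' + a2), (b' + b2); split=> //; [apply: IHn | lia | lia].
Qed.

Lemma region_pow_seq (T : region) (w : seq mon) :
  (forall m, m \in w -> T (m vx) (m vy)) ->
  region_pow T (size w) (degsum vx w) (degsum vy w).
Proof.
elim: w => //= m w IHw Tw; rewrite !degsum_cons.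
exists (m vx), (m vy), (degsum vx w), (degsum vy w); split=> //.
  by apply: Tw; rewrite mem_head.
by apply: IHw => m' m'w; apply: Tw; rewrite in_cons m'w orbT.
Qed.

Lemma region_pow_gens (G : mon -> Prop) n a b : region_pow (up G) n a b ->
  exists w, [/\ size w = n, forall m, m \in w -> G m, degsum vx w <= a & degsum vy w <= b].
Proof.
elim: n a b => [|n IHn] a b /=.
  by exists [::]; rewrite /degsum !big_nil.
move=> [a1 [b1 [a2 [b2 [[m Gm [lex ley]] /IHn[w [sw Gw lea leb]] -> ->]]]]].
exists (m :: w); rewrite /= sw !degsum_cons; split=> //; try lia.
by move=> m'; rewrite in_cons => /orP[/eqP -> | /Gw].
Qed.

Lemma take_out n (m : mon) w : n <= count_mem m w ->
  exists w', perm_eq w (nseq n m ++ w').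
Proof.
move=> le; exists (nseq (count_mem m w - n) m ++ filter (predC1 m) w).
rewrite catA -nseqD subnKC //.
have -> : nseq (count_mem m w) m = filter (pred1 m) w.
  by rewrite -size_filter; apply/esym/all_pred1P; apply: filter_all.
by rewrite perm_sym; apply/permPl/perm_filterC.
Qed.

(** Bounding a length by multiplicities turns bounds for single generators into
a bound for the number of factors. *)
Lemma size_le_counts (R s : seq mon) : {subset s <= R} ->
  size s <= \sum_(f <- R) count_mem f s.
Proof.
elim: s => //= x s IHs sub.
have -> : \sum_(f <- R) ((x == f) + count_mem f s) =
    count_mem x R + \sum_(f <- R) count_mem f s.
  rewrite big_split; congr (_ + _).
  by elim: (R) => [|y R' IHR]; rewrite ?big_nil // big_cons IHR eq_sym.
have : 0 < count_mem x R by rewrite -has_count has_pred1 sub // mem_head.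
have := IHs (fun y ys => sub y (mem_behead (s := x :: s) ys)).
by move=> le pos; rewrite -addn1 addnC leq_add.
Qed.

Lemma sum_le_size (s : seq mon) (f : mon -> nat) e :
  (forall m, m \in s -> f m <= e) -> \sum_(m <- s) f m <= size s * e.
Proof.
elim: s => [|x s IHs] le; first by rewrite big_nil.
rewrite big_cons mulSn leq_add ?le ?mem_head ?IHs // => m ms.
by apply: le; rewrite in_cons ms orbT.
Qed.

Lemma pair_seq (g h : mon) w : {subset w <= [:: g; h]} ->
  exists p q, p + q = size w /\ forall c, degsum c w = p * g c + q * h c.
Proof.
elim: w => [|m w IHw] sub; first by exists 0, 0; split=> // c; rewrite /degsum big_nil.
have [p [q [pq eqw]]] := IHw (fun y yw => sub y (mem_behead (s := m :: w) yw)).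
have := sub m (mem_head m w); rewrite !inE => /orP[] /eqP ->.
  exists p.+1, q; split=> [|c]; first by rewrite addSn pq.
  by rewrite degsum_cons eqw mulSn addnA.
exists p, q.+1; split=> [|c]; first by rewrite addnS pq.
by rewrite degsum_cons eqw mulSn addnCA.
Qed.

(** With f = (x0 + p, y0 + q) on or above the segment from (x0, y0 + v) to
(x0 + u, y0), this compares f^u with a product of u endpoints of the same
x-degree. *)
Lemma segment_exchange x0 y0 u v p q : p <= u -> u * v <= p * v + q * u ->
  (u - p) * x0 + p * (x0 + u) <= u * (x0 + p) /\
  (u - p) * (y0 + v) + p * y0 <= u * (y0 + q).
Proof.
move=> /subnKC <-; move: (u - p) => e; rewrite addKn !mulnDl !mulnDr => le.
by split; lia.
Qed.

(** Moving two weighted points to their barycentre strictly lowers the sum of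
squares; this makes the exchange of non-neighbours terminate. *)
Lemma square_convex a u1 u2 : 0 < u1 -> 0 < u2 ->
  (u1 + u2) * (a + u1) ^ 2 < u2 * a ^ 2 + u1 * (a + (u1 + u2)) ^ 2.
Proof.
move=> pos1 pos2; have pos : 0 < u1 * (u2 * (u1 + u2)) by rewrite !muln_gt0 addn_gt0 pos1 pos2.
rewrite !expnS !expn0 !muln1; lia.
Qed.

Lemma gen_at_in (P : seq mon) k i : size P = k.+1 -> 0 < i <= k.+1 -> gen_at P i \in P.
Proof. by move=> sP ik; apply: mem_nth; rewrite sP; lia. Qed.

Lemma gen_at_index (P : seq mon) k f : size P = k.+1 -> f \in P ->
  exists2 i, 0 < i <= k.+1 & f = gen_at P i.
Proof. by move=> sP /(nthP 0%MM)[i]; rewrite sP => lti <-; exists i.+1. Qed.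

Section Decomposition.
Variables (G P : seq mon) (k A B d delta : nat).
Hypotheses (PG : {subset P <= G}) (uP : uniq P) (sP : size P = k.+1).
Local Notation g := (gen_at P).
Hypothesis gx : forall i, 0 < i <= k -> g i vx < g i.+1 vx.
Hypothesis gy : forall i, 0 < i <= k -> g i.+1 vy < g i vy.
Hypotheses (PA : forall f, f \in P -> f vx <= A) (PB : forall f, f \in P -> f vy <= B).
Hypothesis convex : forall i m j, 0 < i -> i < m -> m < j -> j <= k.+1 ->
  (g m vx - g i vx) * (g m vy - g j vy) <= (g j vx - g m vx) * (g i vy - g m vy).
Hypothesis above : forall f, f \in G -> f \notin P -> exists i,
  [/\ 0 < i <= k, g i vx < f vx < g i.+1 vx, g i.+1 vy < f vy < g i vy &
    (g i.+1 vx - g i vx) * (g i vy - g i.+1 vy) <=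
      (f vx - g i vx) * (g i vy - g i.+1 vy) + (f vy - g i.+1 vy) * (g i.+1 vx - g i vx)].
Hypothesis delta_ge : forall i, 0 < i <= k ->
  minn (g i.+1 vx - g i vx) (g i vy - g i.+1 vy) - 1 <= delta.
Hypothesis dE : 1 < k -> d = minn A B - 2.

(** Each factor outside P weighs more than any element of P, so exchanging it for
elements of P lowers the potential. The elements of P are weighted by a convex
function of one coordinate. *)
Let wt (c : 'I_2) (m : mon) : nat := if m \in P then m c ^ 2 else ((A + B) ^ 2).+1.
Let pot c (w : seq mon) : nat := \sum_(m <- w) wt c m.

Lemma wt_lt c f m : f \in P -> m \notin P -> wt c f < wt c m.
Proof.
rewrite /wt => fP /negPf ->; rewrite fP ltnS leq_exp2r //.
by case: (ord2P c) => ->; have := PA fP; have := PB fP; lia.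
Qed.

Section Minimal.
Variables (c : 'I_2) (w : seq mon).
Hypothesis wG : {subset w <= G}.
Hypothesis wmin : forall w', size w' = size w -> {subset w' <= G} ->
  degsum vx w' <= degsum vx w -> degsum vy w' <= degsum vy w -> pot c w <= pot c w'.

(** The exchanged product is again one of those among which [w] has the least
potential. *)
Lemma exchange z z' w' : perm_eq w (z ++ w') -> size z' = size z -> {subset z' <= G} ->
  degsum vx z' <= degsum vx z -> degsum vy z' <= degsum vy z -> pot c z <= pot c z'.
Proof.
move=> eqw sz z'G lex ley; have := wmin (w' := z' ++ w').
rewrite size_cat sz -size_cat (perm_size eqw) => /(_ erefl).
rewrite /pot !(degsum_perm _ eqw) (perm_big _ eqw) /= !big_cat /= !degsum_cat.
rewrite !leq_add2r; apply=> // m; rewrite mem_cat => /orP[/z'G // | mw].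
by apply: wG; rewrite (perm_mem eqw) mem_cat mw orbT.
Qed.

(** Otherwise min(u_i, v_i) equal factors could be exchanged for endpoints of
the segment below them. *)
Lemma count_nonP f : f \in G -> f \notin P -> count_mem f w <= delta.
Proof.
move=> fG fP; rewrite leqNgt; apply/negP => lt.
have [i [ik /andP[x1 x2] /andP[y1 y2] ab]] := above fG fP.
have := delta_ge ik; set u := g i.+1 vx - g i vx in ab *.
set v := g i vy - g i.+1 vy in ab *; move=> led.
have gi : g i \in P by apply: (gen_at_in sP); lia.
have gi' : g i.+1 \in P by apply: (gen_at_in sP); lia.
have swap n p q : 0 < n -> n <= count_mem f w -> p + q = n ->
    p * g i vx + q * g i.+1 vx <= n * f vx -> p * g i vy + q * g i.+1 vy <= n * f vy -> False.
  move=> n0 len pq lex ley; have [w' eqw] := take_out len.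
  have := exchange (z' := nseq p (g i) ++ nseq q (g i.+1)) eqw.
  rewrite !size_cat !size_nseq !degsum_cat !degsum_nseq pq => /(_ erefl).
  have sub : {subset nseq p (g i) ++ nseq q (g i.+1) <= G}.
    by move=> m; rewrite mem_cat !mem_nseq => /orP[] /andP[_ /eqP ->]; apply: PG.
  move=> /(_ sub lex ley); rewrite /pot big_cat /= !sum_nseq -pq.
  have w1 := wt_lt c gi fP; have w2 := wt_lt c gi' fP.
  by nia.
have above_yx : v * u <= (f vy - g i.+1 vy) * u + (f vx - g i vx) * v by lia.
have lepu : f vx - g i vx <= u by rewrite /u; lia.
have leqv : f vy - g i.+1 vy <= v by rewrite /v; lia.
case: (leqP u v) => cmp.
  have [lex ley] := segment_exchange (g i vx) (g i.+1 vy) lepu ab.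
  apply: (swap u (u - (f vx - g i vx)) (f vx - g i vx)); rewrite /u /v in lex ley cmp led *; lia.
have [lex ley] := segment_exchange (g i.+1 vy) (g i vx) leqv above_yx.
apply: (swap v (f vy - g i.+1 vy) (v - (f vy - g i.+1 vy)));
  rewrite /u /v in lex ley cmp led *; lia.
Qed.

Hypothesis cE : (c = vx /\ A <= B) \/ (c = vy /\ B <= A).

(** Otherwise g_i and g_j could be exchanged for g_(i+1), with the multiplicities
that keep the degree in the chosen variable. *)
Lemma count_far i j : 0 < i -> i.+1 < j -> j <= k.+1 ->
  d < count_mem (g i) w -> d < count_mem (g j) w -> False.
Proof.
move=> i0 ltij lejk ci cj; have dE' : d = minn A B - 2 by apply: dE; lia.
have x1 : g i vx < g i.+1 vx by apply: (chain_lt (f := fun i => g i vx) gx); lia.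
have x2 : g i.+1 vx < g j vx by apply: (chain_lt (f := fun i => g i vx) gx); lia.
have y1 : g i.+1 vy < g i vy by apply: (chain_gt (f := fun i => g i vy) gy); lia.
have y2 : g j vy < g i.+1 vy by apply: (chain_gt (f := fun i => g i vy) gy); lia.
have gi : g i \in P by apply: (gen_at_in sP); lia.
have gj : g j \in P by apply: (gen_at_in sP); lia.
have gm : g i.+1 \in P by apply: (gen_at_in sP); lia.
have conv := convex i0 (ltnSn i) ltij lejk.
have xA := PA gj; have yB := PB gi.
have swap n1 n2 : n1 <= d.+1 -> n2 <= d.+1 ->
    (n1 + n2) * g i.+1 vx <= n1 * g i vx + n2 * g j vx ->
    (n1 + n2) * g i.+1 vy <= n1 * g i vy + n2 * g j vy ->
    (n1 + n2) * g i.+1 c ^ 2 < n1 * g i c ^ 2 + n2 * g j c ^ 2 -> False.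
  move=> le1 le2 lex ley ltc; have [w1 eqw1] := take_out (leq_trans le1 ci).
  have neq : g i != g j by apply/eqP => e; move: x1 x2; rewrite -e; lia.
  have [|w2 eqw2] := @take_out n2 (g j) w1.
    apply: leq_trans le2 (leq_trans cj _); rewrite (permP eqw1) count_cat count_nseq /=.
    by rewrite (negPf neq) mul0n.
  have := @exchange (nseq n1 (g i) ++ nseq n2 (g j)) (nseq (n1 + n2) (g i.+1)) w2.
  rewrite -catA (permPl eqw1) perm_cat2l eqw2 !size_cat !size_nseq.
  rewrite !degsum_cat !degsum_nseq => /(_ isT erefl).
  have sub : {subset nseq (n1 + n2) (g i.+1) <= G}.
    by move=> m; rewrite mem_nseq => /andP[_ /eqP ->]; apply: PG.
  move=> /(_ sub lex ley); rewrite /pot big_cat /= !sum_nseq /wt gi gj gm.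
  by rewrite leqNgt ltc.
case: cE => -[ec cmp].
  apply: (swap (g j vx - g i.+1 vx) (g i.+1 vx - g i vx)); try lia.
  have := @square_convex (g i vx) (g i.+1 vx - g i vx) (g j vx - g i.+1 vx).
  rewrite !subn_gt0 ec subnKC; last by lia.
  have -> : g i vx + (g i.+1 vx - g i vx + (g j vx - g i.+1 vx)) = g j vx by lia.
  by move=> /(_ x1 x2); rewrite [X in X * _]addnC.
apply: (swap (g i.+1 vy - g j vy) (g i vy - g i.+1 vy)); try lia.
have := @square_convex (g j vy) (g i.+1 vy - g j vy) (g i vy - g i.+1 vy).
rewrite !subn_gt0 ec subnKC; last by lia.
have -> : g j vy + (g i.+1 vy - g j vy + (g i vy - g i.+1 vy)) = g i vy by lia.
by move=> /(_ y2 y1); rewrite [X in _ < X]addnC.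
Qed.

(** Among the elements of P only two neighbours can have multiplicity above d
([count_far]); all other multiplicities are bounded by d or delta. *)
Lemma few_outside_pair : 0 < k -> exists2 i, 0 < i <= k &
  size [seq m <- w | m \notin [:: g i; g i.+1]] <= (size G - k.+1) * delta + k.+1 * d.
Proof.
move=> k0.
have [i ik smalli] : exists2 i, 0 < i <= k & forall j, 0 < j <= k.+1 ->
    j != i -> j != i.+1 -> count_mem (g j) w <= d.
  case: (classic (exists j, 0 < j <= k.+1 /\ d < count_mem (g j) w)) => [big | nobig].
    case: big => j0 big0; pose isbig j := 0 < j <= k.+1 /\ d < count_mem (g j) w.
    have [j [[jk bigj] minj]] := @argmin_nat nat isbig id j0 big0.
    (* The least index of high multiplicity is j; the pair starts at j, or at k if j = k + 1. *)
    exists (minn j k); first by lia.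
    move=> j' jk' ne1 ne2; rewrite leqNgt; apply/negP => big'.
    have := minj j' (conj jk' big') => le.
    by apply: (@count_far j j'); lia.
  exists 1; first by lia.
  by move=> j jk _ _; rewrite leqNgt; apply/negP => bigj; apply: nobig; exists j.
exists i => //; set rest := [seq m <- w | _].
pose P' := [seq m <- P | m \notin [:: g i; g i.+1]].
pose N' := [seq m <- G | m \notin P].
have cover : {subset rest <= N' ++ P'}.
  move=> m; rewrite mem_cat !mem_filter => /andP[-> mw] /=.
  by rewrite (wG mw) andbT; case: (m \in P).
apply: leq_trans (size_le_counts cover) _; rewrite big_cat /=.
have count_rest m : count_mem m rest <= count_mem m w.
  by rewrite count_filter; apply: sub_count => x /andP[].
apply: leq_add.
  have sizeN : size N' <= size G - k.+1.
    have <- : size [seq m <- G | m \in P] + size N' = size G.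
      by rewrite !size_filter; apply: (count_predC (mem P)).
    rewrite -sP -[X in X <= _](addKn (size P)) leq_sub2r // leq_add2r.
    by apply: uniq_leq_size => // m mP; rewrite mem_filter mP PG.
  apply: leq_trans (leq_mul sizeN (leqnn delta)); apply: sum_le_size => m.
  rewrite mem_filter => /andP[mP mG]; apply: leq_trans (count_rest m) _.
  exact: count_nonP.
have sizeP' : size P' <= k.+1 by rewrite -sP size_filter count_size.
apply: leq_trans (leq_mul sizeP' (leqnn d)); apply: sum_le_size => m.
rewrite mem_filter !inE negb_or => /andP[/andP[ne1 ne2] /(gen_at_index sP)[j jk ej]].
apply: leq_trans (count_rest m) _; rewrite ej; apply: smalli => //.
  by apply: contraNneq ne1 => <-; rewrite ej.
by apply: contraNneq ne2 => <-; rewrite ej.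
Qed.
End Minimal.

(** Among the products of [t] generators dividing the given monomial, one of
least potential has at most [D] factors outside some pair of neighbours. *)
Lemma pow_decomposition D t a b : 0 < k ->
  (size G - k.+1) * delta + k.+1 * d <= D -> D <= t ->
  region_pow (up (fun m => m \in G)) t a b ->
  exists i p q a' b', [/\ 0 < i <= k, p + q = t - D,
    region_pow (up (fun m => m \in G)) D a' b',
    p * g i vx + q * g i.+1 vx + a' <= a & p * g i vy + q * g i.+1 vy + b' <= b].
Proof.
move=> k0 leD leDt /region_pow_gens[w0 [sw0 Gw0 lea0 leb0]].
(* The bound d comes from the smaller of the two distances, so exchanges of
   non-neighbours must preserve the degree in that variable. *)
pose c := if A <= B then vx else vy.
have cE : (c = vx /\ A <= B) \/ (c = vy /\ B <= A).
  by rewrite /c; case: (leqP A B) => [|/ltnW] le; [left | right].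
pose Q w := [/\ size w = t, {subset w <= G}, degsum vx w <= a & degsum vy w <= b].
have Q0 : Q w0 by [].
have [w [[sw wG lea leb] minw]] := argmin_nat (pot c) Q0.
have [|i ik few] := few_outside_pair (w := w) wG _ cE k0.
  move=> w' sw' w'G lex ley; apply: minw; split=> //; first by rewrite sw'.
    exact: leq_trans lex lea.
  exact: leq_trans ley leb.
set pr := fun m => m \in [:: g i; g i.+1].
have eqw : perm_eq w (filter pr w ++ filter (predC pr) w).
  by rewrite perm_sym; apply/permPl/perm_filterC.
pose w1 := take (t - D) (filter pr w).
pose w2 := drop (t - D) (filter pr w) ++ filter (predC pr) w.
have eqw12 : perm_eq w (w1 ++ w2) by rewrite catA cat_take_drop.
have sizes : size (filter pr w) + size (filter (predC pr) w) = t.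
  by rewrite -size_cat -(perm_size eqw).
have few' := leq_trans few leD.
have sw1 : size w1 = t - D by rewrite size_takel // leq_subLR -{1}sizes addnC leq_add2r.
have sw2 : size w2 = D.
  by apply/eqP; rewrite -(eqn_add2l (t - D)) -{1}sw1 -size_cat -(perm_size eqw12) sw subnK.
have [p [q [pq degw1]]] : exists p q, p + q = size w1 /\
    forall c', degsum c' w1 = p * g i c' + q * g i.+1 c'.
  by apply: pair_seq => m /mem_take; rewrite mem_filter => /andP[].
exists i, p, q, (degsum vx w2), (degsum vy w2); split; rewrite -?degw1 //.
- by rewrite pq.
- rewrite -sw2; apply: region_pow_seq => m mw2; exists m => //.
  by apply: wG; rewrite (perm_mem eqw12) mem_cat mw2 orbT.
- by rewrite -degsum_cat -(degsum_perm _ eqw12).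
by rewrite -degsum_cat -(degsum_perm _ eqw12).
Qed.
End Decomposition.

(** * Distances, thresholds and the order of the links *)

Lemma dist_anchor (K : fieldType) (I : ideal K) F c : antitone F -> vanishes F ->
  anchor I = ideal_of K (right_of F) -> dist c I = dist c (ideal_of K (right_of F)).
Proof. by move=> aF vF aI; rewrite /dist aI anchor_right_of. Qed.

(** Dividing by the gcd turns the pair into (y^v, x^u). *)
Lemma dist_pairE (K : fieldType) (g h : mon) : g vx < h vx -> h vy < g vy ->
  dist_pair K vx g h = h vx - g vx /\ dist_pair K vy g h = g vy - h vy.
Proof.
move=> ltx lty; set u := h vx - g vx; set v := g vy - h vy.
have u0 : 0 < u by rewrite /u; lia.
have v0 : 0 < v by rewrite /v; lia.
pose F b := if b < v then u else 0.
have aF : antitone F by move=> b b' le; rewrite /F; case: (ltnP b v); case: (ltnP b' v); lia.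
have Fv : F v = 0 by rewrite /F ltnn.
have cv : corner F v by apply/cornerP => z ltz; rewrite Fv /F ltz.
have vF : vanishes F by exists v.
have aI : anchor (mon_gens K [:: g; h]) = ideal_of K (right_of F).
  rewrite /mon_gens mon_gen_region /anchor (@gcd_idealE _ _ (xy (g vx) (h vy))).
    rewrite colon_region; apply: ideal_of_ext => a b; rewrite xy_vx xy_vy /right_of /F.
    split=> [[m] | ].
      by rewrite !inE => /orP[] /eqP -> []; case: ltnP => //; rewrite /u /v; lia.
    case: ltnP => [lt le | le _].
      by exists h; rewrite ?inE ?eqxx ?orbT //; rewrite /u in le; lia.
    by exists g; rewrite ?inE ?eqxx //; rewrite /v in le; lia.
  split=> [m /ideal_of_mon[m'] | e dvd].
    by rewrite !inE => /orP[] /eqP -> [le1 le2]; apply/mon_leP; rewrite xy_vx xy_vy; lia.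
  apply/mon_leP; rewrite xy_vx xy_vy; split.
    by have /mon_leP[] : (e <= g)%MM by apply: dvd; apply/ideal_of_mon; exists g;
      rewrite ?inE ?eqxx.
  by have /mon_leP[] : (e <= h)%MM by apply: dvd; apply/ideal_of_mon; exists h;
    rewrite ?inE ?eqxx ?orbT.
rewrite /dist_pair !(dist_anchor _ aF vF aI) dist_vx_right_of // (dist_vy_right_of K aF Fv cv).
by rewrite /F v0.
Qed.

(** The ceiling is nonnegative, so s > D, and the inequality says that the height
D dist_y(I) of I^D is at most r v_i for every i. *)
Lemma r_y_bound (K : fieldType) (I : ideal K) (P : seq mon) (D s : nat) :
  (forall i, 0 < i < size P -> 0 < v_at K P i) ->
  (D%:Z + r_y I P D + 1 <= s%:Z)%R ->
  D < s /\ forall i, 0 < i < size P -> D * dist vy I <= (s - D - 1) * v_at K P i.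
Proof.
move=> vpos; rewrite /r_y; set M := (\big[Num.max/0%R]_(1 <= i < size P) _)%R.
have M0 : (0 <= M)%R.
  by rewrite /M; elim/big_rec: _ => // i x _ x0; rewrite le_max x0 orbT.
have leM i : 0 < i < size P -> ((dist vy I)%:R / (v_at K P i)%:R <= M :> rat)%R.
  move=> ik; apply: (le_bigmax_seq _ i xpredT) => //.
  by rewrite mem_index_iota.
have c0 : (0 <= Num.ceil (D%:R * M : rat))%R.
  by rewrite -(ceil0 rat) le_ceil // mulr_ge0.
move=> les; have ltD : D < s by move: les c0; set c := Num.ceil _; lia.
split=> // i ik.
have lec : (Num.ceil (D%:R * M : rat) <= (s - D - 1)%N%:Z)%R.
  by move: les; set c := Num.ceil _; lia.
move: lec; rewrite ceil_le_int => lec.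
have v0 : (0 < (v_at K P i)%:R :> rat)%R by rewrite ltr0n vpos.
have := le_trans (ler_wpM2l (ler0n _ D) (leM i ik)) lec.
rewrite mulrA ler_pdivrMr // -natrM -pmulrn -natrM ler_nat.
by [].
Qed.

Section Assembly.
Variables (K : fieldType) (I : ideal K) (P : seq mon) (D s l k : nat).
Variable cutI : nat -> nat -> ideal K.
Hypotheses (k_gt0 : 0 < k) (sP : (size P).-1 = k).
Hypothesis first : comp_C I P D s 0 = cutI 1 l.
Hypothesis stepH : forall i m, 0 < i <= k -> m < l ->
  link (cutI i m.+1) (comp_H I P D s i) = cutI i m.
Hypothesis stepC : forall i, 0 < i <= k ->
  link (cutI i 0) (comp_C I P D s i) = cutI i.+1 l.

Lemma foldl_H i m : 0 < i <= k -> m <= l ->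
  foldl (@link K) (cutI i l) (nseq m (comp_H I P D s i)) = cutI i (l - m).
Proof.
move=> ik; elim: m => [|m IHm] le; first by rewrite subn0.
rewrite -addn1 nseqD foldl_cat /= IHm ?(ltnW le) // addn1.
by have -> : l - m = (l - m.+1).+1 by [lia]; rewrite stepH //; lia.
Qed.

(** The links are taken from left to right, which is from the top of the
staircase to its bottom. Here [cutI i m] stands for the part that has been
built when [m] copies of H_i are still to come. *)
Lemma stable_link_cut : stable_link I P D s l = cutI k.+1 l.
Proof.
rewrite /stable_link sP.
suff chain j : j <= k -> foldl (@link K) (comp_C I P D s 0)
    (flatten [seq rcons (nseq l (comp_H I P D s i)) (comp_C I P D s i) | i <- iota 1 j]) =
    cutI j.+1 l by apply: chain.
elim: j => [|j IHj] lej //.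
have -> : iota 1 j.+1 = iota 1 j ++ [:: j.+1].
  by rewrite -[X in iota 1 X](addn1 j) iotaD.
rewrite map_cat flatten_cat foldl_cat IHj; last exact: ltnW.
rewrite /= cats0 foldl_rcons foldl_H // subnn stepC //.
Qed.
End Assembly.

(** * Persistent generators *)

Lemma region_pow_axes T n a b : upset T -> T a 0 -> T 0 b ->
  region_pow T n (n * a) 0 /\ region_pow T n 0 (n * b).
Proof.
move=> upT Ta Tb; elim: n => [|n [IHa IHb]] //=; split.
  by exists a, 0, (n * a), 0; rewrite mulSn.
by exists 0, b, 0, (n * b); rewrite mulSn.
Qed.

Lemma region_pow_right_of F B n : antitone F -> F B = 0 ->
  exists h, [/\ antitone h, h (n * B) = 0 &
    forall a b, region_pow (right_of F) n a b <-> right_of h a b].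
Proof.
move=> aF FB; have upF := right_of_upset aF.
have [] := @region_pow_axes (right_of F) n (F 0) B upF (leqnn _).
  by rewrite /right_of FB.
by move=> pa pb; apply: upset_right_of pa pb; apply: region_pow_upset.
Qed.

(** If two points lie strictly below a line through (f1, f2), on either side of
it, so does the point of their segment at height f2. *)
Lemma segment_lt (f1 f2 a1 b1 a2 b2 p q : nat) : b1 < f2 -> f2 < b2 ->
  p * a1 + q * b1 < p * f1 + q * f2 -> p * a2 + q * b2 < p * f1 + q * f2 ->
  (b2 - f2) * a1 + (f2 - b1) * a2 < (b2 - b1) * f1.
Proof.
move=> lt1 lt2 l1 l2; have p0 : 0 < p by nia.
have w1 : 0 < b2 - f2 by lia.
have w2 : 0 < f2 - b1 by lia.
have -> : b2 - b1 = (b2 - f2) + (f2 - b1) by lia.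
have e2 : b2 = f2 + (b2 - f2) by lia.
have e1 : f2 = b1 + (f2 - b1) by lia.
rewrite -(ltn_pmul2l p0); move: w1 w2 e1 e2 l1 l2.
move: (b2 - f2) (f2 - b1) => v1 v2 w1 w2 e1 e2 l1 l2.
have := leq_add (leq_mul (leqnn v1) l1) (leq_mul (leqnn v2) l2).
by rewrite e2 e1; nia.
Qed.

Lemma segment_coord z0 z1 p q : z0 <= z1 ->
  p * z0 + q * z1 = (p + q) * z0 + (z1 - z0) * q.
Proof. by move=> le; rewrite -{1}(subnKC le); lia. Qed.

Section Persistence.
Variables (K : fieldType) (F : nat -> nat) (B : nat).
Hypotheses (aF : antitone F) (FB : F B = 0) (cB : corner F B) (F0 : 0 < F 0).
Local Notation I := (ideal_of K (right_of F)).

Let vF : vanishes F := ex_intro _ B FB.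

Lemma zero_ge_B b : F b = 0 -> B <= b.
Proof. by move=> Fb; rewrite leqNgt; apply/negP => /(cornerP _ _ cB); rewrite FB Fb. Qed.

Lemma corner_le_B b : corner F b -> b <= B.
Proof. by move=> /cornerP cb; rewrite leqNgt; apply/negP => /cb; rewrite FB. Qed.

Lemma weakly_persistent_corner f : weakly_persistent I f ->
  f vx = F (f vy) /\ corner F (f vy).
Proof.
by case; case: (mingens_right_of K aF vF) => _ ->; case/andP => /eqP.
Qed.

(** The n-th power of f is a minimal generator of I^n, so nothing in I^n strictly
divides it. *)
Lemma weakly_persistent_min f n a b : weakly_persistent I f -> 0 < n ->
  region_pow (right_of F) n a b -> a <= n * f vx -> b <= n * f vy ->
  a = n * f vx /\ b = n * f vy.
Proof.
move=> [_ wf] n0; have [h [ah hB eqh]] := @region_pow_right_of F B n aF FB.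
have := wf n n0; rewrite ideal_pow_region (ideal_of_ext K eqh).
have [_ ->] := mingens_right_of K ah (ex_intro _ _ hB).
rewrite !mulmnE ![f _ * n]mulnC => /andP[/eqP fx /cornerP cf] /eqh hab lea leb.
have eqb : b = n * f vy.
  apply/eqP; rewrite eqn_leq leb leqNgt; apply/negP => /cf; rewrite -fx ltnNge.
  by move/negP; apply; apply: leq_trans hab lea.
by split=> //; apply/eqP; rewrite eqn_leq lea fx -eqb; apply: hab.
Qed.

(** A suitable product of the two points would strictly divide a power of f. *)
Lemma weakly_persistent_segment f a1 b1 a2 b2 p q : weakly_persistent I f ->
  right_of F a1 b1 -> right_of F a2 b2 -> b1 < f vy -> f vy < b2 ->
  p * a1 + q * b1 < p * f vx + q * f vy ->
  p * a2 + q * b2 < p * f vx + q * f vy -> False.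
Proof.
move=> wf T1 T2 lt1 lt2 l1 l2.
have lt := segment_lt lt1 lt2 l1 l2.
pose w := nseq (b2 - f vy) (xy a1 b1) ++ nseq (f vy - b1) (xy a2 b2).
have := @region_pow_seq (right_of F) w; rewrite size_cat !size_nseq !degsum_cat !degsum_nseq.
rewrite !xy_vx !xy_vy => pw.
have [] := weakly_persistent_min wf _ (pw _).
- by lia.
- by move=> m; rewrite mem_cat !mem_nseq => /orP[] /andP[_ /eqP ->]; rewrite xy_vx xy_vy.
- by rewrite (_ : b2 - f vy + (f vy - b1) = b2 - b1); [apply: ltnW | lia].
- by nia.
by rewrite (_ : b2 - f vy + (f vy - b1) = b2 - b1); lia.
Qed.

(** The product of g and h with the x-degree of a power of f is in I^n, so it
cannot have a smaller y-degree. *)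
Lemma weakly_persistent_convex (f g h : mon) : weakly_persistent I f ->
  right_of F (g vx) (g vy) -> right_of F (h vx) (h vy) ->
  g vx < f vx -> f vx < h vx -> f vy < g vy -> h vy < f vy ->
  (f vx - g vx) * (f vy - h vy) <= (h vx - f vx) * (g vy - f vy).
Proof.
move=> wf Tg Th x1 x2 y1 y2; rewrite leqNgt; apply/negP => lt.
pose w := nseq (h vx - f vx) g ++ nseq (f vx - g vx) h.
have := @region_pow_seq (right_of F) w; rewrite size_cat !size_nseq !degsum_cat !degsum_nseq.
move=> pw; have [] := weakly_persistent_min wf _ (pw _).
- by lia.
- by move=> m; rewrite mem_cat !mem_nseq => /orP[] /andP[_ /eqP ->].
- by nia.
- by nia.
by nia.
Qed.

(** The linear form is at least its minimum plus 1 on g and h, hence at least n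
times that on every monomial of (g,h)^n, and so on the integral closure. *)
Lemma persistent_of_linear (p q : nat) (f : mon) : right_of F (f vx) (f vy) ->
  (forall a b, right_of F a b -> (a, b) <> (f vx, f vy) ->
    p * f vx + q * f vy < p * a + q * b) ->
  persistent I f.
Proof.
move=> Tf minf.
have fx : f vx = F (f vy).
  apply/eqP; rewrite eqn_leq [X in _ && X]Tf andbT leqNgt; apply/negP => lt.
  have := minf (F (f vy)) (f vy) (leqnn _).
  have le := leq_mul (leqnn p) (ltnW lt).
  by case=> [[e] | ]; lia.
have cf : corner F (f vy).
  apply/cornerP => z ltz; rewrite ltnNge; apply/negP => lez.
  have := minf (f vx) z; rewrite /right_of {1}fx => /(_ lez).
  have le := leq_mul (leqnn q) (ltnW ltz).
  by case=> [[e] | ]; lia.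
split; first by case: (mingens_right_of K aF vF) => _ ->; rewrite fx eqxx cf.
move=> g h /ideal_of_mon Tg gf /ideal_of_mon Th hf.
rewrite /int_closure mon_gen_region => /ideal_of_mon[e [n [n0]]].
rewrite mpolyXn /mon_gens mon_gen_region ideal_pow_region => /ideal_of_mon.
move=> /region_pow_gens[w [sw wgh]]; rewrite !mulmnE => lex ley [lefx lefy].
have [p' [q' [pq degw]]] := pair_seq wgh.
have neq (m : mon) : m <> f -> (m vx, m vy) <> (f vx, f vy).
  by move=> ne [ex ey]; apply: ne; apply: mon_ext.
have ltg := minf _ _ Tg (neq _ gf); have lth := minf _ _ Th (neq _ hf).
rewrite !degw in lex ley.
have := leq_add (leq_mul (leqnn p') ltg) (leq_mul (leqnn q') lth).
have := leq_mul (leqnn p) (leq_trans lex (leq_mul lefx (leqnn n))).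
have := leq_mul (leqnn q) (leq_trans ley (leq_mul lefy (leqnn n))).
rewrite -sw -pq in n0 *; nia.
Qed.

(** The form (B+1) x + y has its minimum there. *)
Lemma top_persistent : persistent I (xy 0 B).
Proof.
apply: (@persistent_of_linear B.+1 1); rewrite xy_vx xy_vy.
  by rewrite /right_of FB.
move=> [|a] b Tab ne; last by nia.
move: Tab; rewrite /right_of leqn0 => /eqP/zero_ge_B leb.
have : b != B by apply/eqP => e; apply: ne; rewrite e.
by lia.
Qed.

Lemma bottom_persistent : persistent I (xy (F 0) 0).
Proof.
apply: (@persistent_of_linear 1 (F 0).+1); rewrite xy_vx xy_vy.
  exact: leqnn.
move=> a [|b] Tab ne; last by nia.
have : a != F 0 by apply/eqP => e; apply: ne; rewrite e.
by rewrite /right_of in Tab; lia.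
Qed.

Variable P : seq mon.
Hypothesis sortP : sorted (fun g h : mon => h vy < g vy) P.
Hypothesis persP : forall f, persistent I f -> f \in P.
Hypothesis wpersP : forall f, f \in P -> weakly_persistent I f.
Local Notation g := (gen_at P).

Lemma top_in : xy 0 B \in P.
Proof. exact/persP/top_persistent. Qed.

Lemma bottom_in : xy (F 0) 0 \in P.
Proof. exact/persP/bottom_persistent. Qed.

Lemma sizeP : 1 < size P.
Proof.
have sub : {subset [:: xy 0 B; xy (F 0) 0] <= P}.
  by move=> m; rewrite !inE => /orP[] /eqP ->; rewrite ?top_in ?bottom_in.
apply: (uniq_leq_size (s1 := [:: xy 0 B; xy (F 0) 0])) => //=.
rewrite inE andbT; apply/eqP => e; have := xy_vx 0 B.
by rewrite e xy_vx => F00; move: F0; rewrite F00.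
Qed.

Local Notation k := (size P).-1.

Lemma sizePk : size P = k.+1.
Proof. by rewrite prednK // ltnW // sizeP. Qed.

Lemma chain_gt0 : 0 < k.
Proof. by rewrite -ltnS -sizePk sizeP. Qed.

Lemma at_y_lt i j : 0 < i -> i < j -> j <= k.+1 -> g j vy < g i vy.
Proof.
move=> i0 ltij lej; rewrite /gen_at.
have trP : transitive (fun g h : mon => h vy < g vy) by move=> x y z h1 h2; apply: ltn_trans h1.
have lti : i.-1 < size P by rewrite sizePk; lia.
have ltj : j.-1 < size P by rewrite sizePk; lia.
have ltij' : i.-1 < j.-1 by lia.
exact: (sorted_ltn_nth trP 0%MM sortP _ _ lti ltj ltij').
Qed.

Lemma at_corner i : 0 < i <= k.+1 -> g i vx = F (g i vy) /\ corner F (g i vy).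
Proof. by move=> /(gen_at_in sizePk)/wpersP; apply: weakly_persistent_corner. Qed.

Lemma at_right_of i : 0 < i <= k.+1 -> right_of F (g i vx) (g i vy).
Proof. by move=> /at_corner[-> _]; apply: leqnn. Qed.

Lemma at_x_lt i j : 0 < i -> i < j -> j <= k.+1 -> g i vx < g j vx.
Proof.
move=> i0 ltij lej; have lty := at_y_lt i0 ltij lej.
have [-> /cornerP ci] : g i vx = F (g i vy) /\ corner F (g i vy) by apply: at_corner; lia.
have [-> _] : g j vx = F (g j vy) /\ corner F (g j vy) by apply: at_corner; lia.
exact: ci.
Qed.

Lemma P_uniq : uniq P.
Proof.
apply: (sorted_uniq _ _ sortP) => [x y z h1 h2 | x]; first exact: ltn_trans h1.
by rewrite ltnn.
Qed.

Lemma P_bounds f : f \in P -> f vx <= F 0 /\ f vy <= B.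
Proof.
move=> /wpersP/weakly_persistent_corner[-> cf]; split; first exact: aF.
exact: corner_le_B.
Qed.

Lemma at_first : g 1 = xy 0 B.
Proof.
have [i ik ei] := gen_at_index sizePk top_in.
case: (ltngtP i 1) => [|gt|e]; [by lia | | by rewrite ei e].
have := @at_y_lt 1 i isT gt ltac:(lia); rewrite -ei xy_vy.
by have [_] := P_bounds (@gen_at_in P k 1 sizePk ltac:(lia)); lia.
Qed.

Lemma at_last : g k.+1 = xy (F 0) 0.
Proof.
have [i ik ei] := gen_at_index sizePk bottom_in.
case: (ltngtP i k.+1) => [lt||e]; [ | by lia | by rewrite ei e].
by have := @at_y_lt i k.+1 ltac:(lia) lt (leqnn _); rewrite -ei xy_vy.
Qed.

Lemma at_convex i m j : 0 < i -> i < m -> m < j -> j <= k.+1 ->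
  (g m vx - g i vx) * (g m vy - g j vy) <= (g j vx - g m vx) * (g i vy - g m vy).
Proof.
move=> i0 ltim ltmj lej; apply: weakly_persistent_convex.
- by apply/wpersP/(gen_at_in sizePk); lia.
- by apply: at_right_of; lia.
- by apply: at_right_of; lia.
- by apply: at_x_lt; lia.
- by apply: at_x_lt; lia.
- by apply: at_y_lt; lia.
- by apply: at_y_lt; lia.
Qed.

Lemma between_index y : y <= B -> (forall i, 0 < i <= k.+1 -> y <> g i vy) ->
  exists2 i, 0 < i <= k & g i.+1 vy < y < g i vy.
Proof.
move=> leB ne; pose isbelow j := 0 < j <= k.+1 /\ g j vy < y.
have last : isbelow k.+1.
  split; first by lia.
  have := ne k.+1 ltac:(lia); rewrite at_last xy_vy; lia.
have [j [[jk ltj] minj]] := @argmin_nat nat isbelow id _ last.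
have j1 : 1 < j.
  case: (ltngtP j 1) => // [|e]; first by lia.
  by move: ltj; rewrite e at_first xy_vy; lia.
exists j.-1; first by lia.
rewrite prednK ?ltj //=; last by lia.
have := ne j.-1 ltac:(lia); case: (ltngtP y (g j.-1 vy)) => // lt _.
have bj : isbelow j.-1 by split=> //; lia.
by have := minj _ bj; rewrite /=; lia.
Qed.

(** Suppose that f lies strictly below the segment from g_i to g_(i+1). Let lam
be the linear form that is constant on this segment. Points of I outside the
strip between the heights of g_i and g_(i+1) are not below the line, by weak
persistence of these two vertices. So a point of the strip minimizing lam, and
then the y-degree, minimizes over all of I the tilted form Lam, uniquely; it is
persistent, hence in P, although no element of P has a height in the strip. *)
Lemma above_chain f : f \in mingens I -> f \notin P -> exists i,
  [/\ 0 < i <= k, g i vx < f vx < g i.+1 vx, g i.+1 vy < f vy < g i vy &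
    (g i.+1 vx - g i vx) * (g i vy - g i.+1 vy) <=
      (f vx - g i vx) * (g i vy - g i.+1 vy) + (f vy - g i.+1 vy) * (g i.+1 vx - g i vx)].
Proof.
case: (mingens_right_of K aF vF) => _ -> /andP[/eqP fx cf] fP.
have [i ik /andP[y1 y2]] : exists2 i, 0 < i <= k & g i.+1 vy < f vy < g i vy.
  apply: between_index => [|i ik e]; first exact: corner_le_B.
  move: fP; suff -> : f = g i by rewrite (gen_at_in sizePk).
  by apply: mon_ext => //; have [-> _] := at_corner ik; rewrite fx e.
have ik1 : 0 < i <= k.+1 by lia.
have ik2 : 0 < i.+1 <= k.+1 by lia.
have [ex1 /cornerP c1] := at_corner ik1; have [ex2 /cornerP c2] := at_corner ik2.
have x1 : g i vx < f vx by rewrite ex1 fx c1.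
have x2 : f vx < g i.+1 vx by rewrite ex2 fx; apply: (cornerP _ _ cf).
exists i; split=> //; [by rewrite x1 | by rewrite y1 | ].
rewrite leqNgt; apply/negP => viol.
set v := g i vy - g i.+1 vy in viol; set u := g i.+1 vx - g i vx in viol.
pose lam a b := v * a + u * b.
have lam_eq : lam (g i vx) (g i vy) = lam (g i.+1 vx) (g i.+1 vy).
  have -> : g i.+1 vx = g i vx + u by rewrite /u; lia.
  have -> : g i vy = g i.+1 vy + v by rewrite /v; lia.
  by rewrite /lam; lia.
have lamf : lam (f vx) (f vy) < lam (g i vx) (g i vy).
  rewrite /lam; have -> : f vx = g i vx + (f vx - g i vx) by lia.
  have -> : f vy = g i.+1 vy + (f vy - g i.+1 vy) by lia.
  have -> : g i vy = g i.+1 vy + v by rewrite /v; lia.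
  by rewrite !mulnDr; lia.
(* As y-degrees in the strip are at most B, adding b breaks ties only. *)
pose Lam a b := B.+1 * lam a b + b.
pose strip y := g i.+1 vy < y < g i vy.
have stripf : strip (f vy) by rewrite /strip y1.
have [y [/andP[ys1 ys2] miny]] := @argmin_nat nat strip (fun y => Lam (F y) y) _ stripf.
have giB : g i vy <= B by have [_] := P_bounds (gen_at_in sizePk ik1).
have lam_lt a b a' b' : b <= B -> Lam a' b' <= Lam a b -> lam a' b' <= lam a b.
  move=> leb; rewrite /Lam => le; rewrite leqNgt; apply/negP => lt.
  by have := leq_mul (leqnn B.+1) lt; lia.
have lamy : lam (F y) y < lam (g i vx) (g i vy).
  apply: leq_ltn_trans lamf; apply: lam_lt; first exact: corner_le_B.
  by rewrite fx; apply: miny.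
have pers : persistent I (xy (F y) y).
  apply: (@persistent_of_linear (B.+1 * v) (B.+1 * u + 1)); rewrite xy_vx xy_vy.
    exact: leqnn.
  move=> a b Tab ne.
  have LamE (c e : nat) : B.+1 * v * c + (B.+1 * u + 1) * e = Lam c e.
    by rewrite /Lam /lam; lia.
  rewrite !LamE.
  case: (boolP (strip b)) => [sb | nsb].
    have le1 := miny _ sb.
    have le2 : lam (F b) b <= lam a b by rewrite /lam leq_add2r leq_mul2l Tab orbT.
    have le3 : Lam (F b) b <= Lam a b by rewrite /Lam leq_add2r leq_mul2l le2.
    rewrite ltn_neqAle (leq_trans le1 le3) andbT; apply/eqP => eqL.
    have eqb : b = y.
      have e1 : Lam (F y) y = Lam (F b) b by lia.
      have lb : b < B.+1 by move: sb; rewrite /strip; lia.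
      have ly : y < B.+1 by lia.
      (* Both heights are the residue of Lam modulo B + 1. *)
      move: e1; rewrite /Lam => /(congr1 (modn^~ B.+1)).
      by rewrite ![B.+1 * _]mulnC !modnMDl !modn_small.
    apply: ne; rewrite eqb; congr (_, _); move: eqL; rewrite eqb /Lam /lam.
    have v0 : 0 < v by rewrite /v; lia.
    move=> /addIn/eqP; rewrite eqn_pmul2l // eqn_add2r eqn_pmul2l //.
    by move=> /eqP.
  have lam0 : lam (g i vx) (g i vy) <= lam a b.
    rewrite leqNgt; apply/negP => lt.
    case: (ltngtP b (g i.+1 vy)) => [ltb | gtb | eqb]; last first.
    - suff : lam (g i.+1 vx) (g i.+1 vy) <= lam a b by rewrite -lam_eq leqNgt lt.
      by rewrite ex2 -eqb /lam leq_add2r leq_mul2l Tab orbT.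
    - have : g i vy <= b by move: nsb; rewrite /strip gtb /= -leqNgt.
      rewrite leq_eqVlt => /orP[/eqP eqb | gtb'].
        suff : lam (g i vx) (g i vy) <= lam a b by rewrite leqNgt lt.
        by rewrite ex1 eqb /lam leq_add2r leq_mul2l Tab orbT.
      have wg : weakly_persistent I (g i) by apply/wpersP/(gen_at_in sizePk).
      exact: (weakly_persistent_segment wg (leqnn (F y)) Tab ys2 gtb' lamy lt).
    have wg : weakly_persistent I (g i.+1) by apply/wpersP/(gen_at_in sizePk).
    rewrite lam_eq in lamy lt.
    exact: (weakly_persistent_segment wg Tab (leqnn (F y)) ltb ys1 lt lamy).
  rewrite /Lam; have := leq_mul (leqnn B.+1) (leq_trans lamy lam0); lia.
have [j jk ej] := gen_at_index sizePk (persP pers).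
have ey : y = g j vy by rewrite -ej xy_vy.
case: (leqP j i) => [le | gt].
  case: (ltngtP j i) => [lt | | e]; [ | by lia | by rewrite e in ey; lia].
  by have := @at_y_lt j i ltac:(lia) lt ltac:(lia); lia.
case: (ltngtP j i.+1) => [ | lt | e]; [by lia | | by rewrite e in ey; lia].
by have := @at_y_lt i.+1 j ltac:(lia) lt ltac:(lia); lia.
Qed.

Lemma uv_atE i : 0 < i <= k ->
  u_at K P i = g i.+1 vx - g i vx /\ v_at K P i = g i vy - g i.+1 vy.
Proof. by move=> ik; apply: dist_pairE; [apply: at_x_lt | apply: at_y_lt]; lia. Qed.

Lemma delta_bound i : 0 < i <= k ->
  minn (g i.+1 vx - g i vx) (g i vy - g i.+1 vy) - 1 <= delta K P.
Proof.
move=> ik; have [<- <-] := uv_atE ik; apply: leq_sub2r.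
apply: (@leq_bigmax_seq _ _ _ (fun i => minn (u_at K P i) (v_at K P i))) => //.
by rewrite mem_index_iota sizePk; lia.
Qed.

(** One inclusion is [pow_decomposition]; the other holds as each g_i is in I. *)
Lemma pow_segments D t a b : D_ I P <= D -> D <= t ->
  region_pow (right_of F) t a b <->
  exists i p q a' b', [/\ 0 < i <= k, p + q = t - D,
    region_pow (right_of F) D a' b',
    p * g i vx + q * g i.+1 vx + a' <= a & p * g i vy + q * g i.+1 vy + b' <= b].
Proof.
move=> leD leDt; split; last first.
  move=> [i [p [q [a' [b' [ik pq pw lea leb]]]]]].
  have rep n j : 0 < j <= k.+1 -> region_pow (right_of F) n (n * g j vx) (n * g j vy).
    move=> jk; have := @region_pow_seq (right_of F) (nseq n (g j)).
    rewrite size_nseq !degsum_nseq; apply=> m; rewrite mem_nseq => /andP[_ /eqP ->].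
    exact: at_right_of.
  have upF := right_of_upset aF.
  have r1 := region_powD upF (rep p i ltac:(lia)) (rep q i.+1 ltac:(lia)).
  have := region_powD upF r1 pw; rewrite pq subnK //.
  exact: region_pow_upset.
have [_ memI] := mingens_right_of K aF vF.
rewrite -(up_mingens K aF vF).
apply: (@pow_decomposition (mingens I) P k (F 0) B (d_ I P) (delta K P)) leDt => //.
- by move=> f /wpersP[].
- exact: P_uniq.
- exact: sizePk.
- by move=> i ik; apply: at_x_lt; lia.
- by move=> i ik; apply: at_y_lt; lia.
- by move=> f /P_bounds[].
- by move=> f /P_bounds[].
- by move=> i m j i0 im mj jk; apply: at_convex.
- by move=> f; apply: above_chain.
- exact: delta_bound.
- by rewrite /d_ sizePk ltnS dist_vx_right_of // (dist_vy_right_of K aF FB cB) => ->.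
- exact: chain_gt0.
by move: leD; rewrite /D_ /mu -sizePk.
Qed.

(** This applies the gluing lemmas with N = s + l - D = (r + 1) + l and with the
profile [h] of I^D, whose height is at most D dist_y(I). *)
Lemma power_stable_link D s l : D_ I P <= D -> D < s ->
  (forall i, 0 < i <= k -> D * B <= (s - D - 1) * v_at K P i) ->
  ideal_pow I (s + l) = stable_link I P D s l.
Proof.
move=> leD ltDs bound; pose r := s - D - 1.
pose xs i := g i vx; pose ys i := g i vy.
have xs_incr i : 0 < i <= k -> xs i < xs i.+1 by move=> ik; apply: at_x_lt; lia.
have ys_decr i : 0 < i <= k -> ys i.+1 < ys i by move=> ik; apply: at_y_lt; lia.
have xs1 : xs 1 = 0 by rewrite /xs at_first xy_vx.
have ysk : ys k.+1 = 0 by rewrite /ys at_last xy_vy.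
have [h [ah hDB eqh]] := @region_pow_right_of F B D aF FB.
have [Y [leY cY hY _]] := last_corner (D * B) ah; rewrite hDB in hY.
have hpos z : z < Y -> 0 < h z by rewrite -hY; move/cornerP: cY; apply.
have rvY i : 0 < i <= k -> Y <= r * (ys i - ys i.+1).
  by move=> ik; have [_ <-] := uv_atE ik; apply: leq_trans leY _; apply: bound.
have u_gt0 i : 0 < i <= k -> 0 < xs i.+1 - xs i by move=> /xs_incr; rewrite subn_gt0.
have v_gt0 i : 0 < i <= k -> 0 < ys i - ys i.+1 by move=> /ys_decr; rewrite subn_gt0.
have [beta cutb] : exists beta, forall i, 0 < i <= k ->
    is_cut (xs i.+1 - xs i) (ys i - ys i.+1) h r (beta i).
  exists (fun i => epsilon (inhabits 0) (is_cut (xs i.+1 - xs i) (ys i - ys i.+1) h r)).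
  move=> i ik; apply: epsilon_spec.
  exact: (cut_exists ah (u_gt0 i ik) (v_gt0 i ik) hY (rvY i ik)).
have [Phi [aPhi Phi0 eqPhi]] := @region_pow_right_of F B (s + l) aF FB.
have vPhi : vanishes Phi by exists ((s + l) * B).
have PhiP a b : Phi b <= a <-> exists i, [/\ 0 < i <= k, (r.+1 + l) * ys i.+1 <= b &
    (r.+1 + l) * xs i + stairpow (xs i.+1 - xs i) (ys i - ys i.+1) h (r.+1 + l)
      (b - (r.+1 + l) * ys i.+1) <= a].
  have eqN : s + l - D = r.+1 + l by rewrite /r; lia.
  have := eqPhi a b; rewrite /right_of => <-; rewrite (pow_segments a b leD); last by lia.
  rewrite eqN; move: (r.+1 + l) => N.
  split=> [[i [p [q [a' [b' [ik pq /eqh hab lea leb]]]]]] | [i [ik leb lea]]].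
    rewrite -/(xs i) -/(xs i.+1) in lea; rewrite -/(ys i) -/(ys i.+1) in leb.
    rewrite (segment_coord p q (ltnW (xs_incr i ik))) pq in lea.
    rewrite (addnC (p * _)) (segment_coord q p (ltnW (ys_decr i ik))) (addnC q) pq in leb.
    exists i; split=> //; first by lia.
    rewrite -leq_subRL; last by lia.
    apply/stairpowP; exists q, p; split; [by rewrite addnC | by lia | ].
    have : h (b - N * ys i.+1 - (ys i - ys i.+1) * p) <= h b' by apply: ah; lia.
    by rewrite /right_of in hab; lia.
  have /stairpowP[q [p [pq leb' lea']]] :
    stairpow (xs i.+1 - xs i) (ys i - ys i.+1) h N (b - N * ys i.+1) <= a - N * xs i by lia.
  set b' := _ - (_ - _) * p in lea'; exists i, p, q, (h b'), b'; split=> //.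
  - by rewrite addnC.
  - by apply/eqh/leqnn.
  - by rewrite -/(xs i) -/(xs i.+1) (segment_coord p q (ltnW (xs_incr i ik))) (addnC p) pq; lia.
  rewrite -/(ys i) -/(ys i.+1) (addnC (p * _)).
  by rewrite (segment_coord q p (ltnW (ys_decr i ik))) pq /b'; lia.
have eqJ : ideal_pow I D = ideal_of K (right_of h) by rewrite ideal_pow_region (ideal_of_ext K eqh).
pose T i m := (r.+1 + l) * ys i.+1 + (beta i + m * (ys i - ys i.+1)).
pose cutI i m := if i == k.+1 then staircase_above K Phi 0 else staircase_above K Phi (T i m).
have cutIE i m : 0 < i <= k -> cutI i m = staircase_above K Phi (T i m).
  by move=> ik; rewrite /cutI; case: eqP => // e; lia.
have AE i : 0 < i <= k -> comp_A I P D s i =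
    seg_A (xs i.+1 - xs i) (ys i - ys i.+1) r (ideal_of K (right_of h)).
  by move=> ik; rewrite /comp_A eqJ; have [-> ->] := uv_atE ik.
have HE i : 0 < i <= k -> comp_H I P D s i =
    seg_H (xs i.+1 - xs i) (ys i - ys i.+1) r (ideal_of K (right_of h)).
  by move=> ik; rewrite /comp_H eqJ; have [-> ->] := uv_atE ik.
have BE i : 0 < i <= k -> comp_B I P D s i =
    seg_B (xs i.+1 - xs i) (ys i - ys i.+1) r (ideal_of K (right_of h)).
  by move=> ik; rewrite /comp_B eqJ; have [-> ->] := uv_atE ik.
have k1 : 0 < 1 <= k by rewrite chain_gt0.
rewrite (@stable_link_cut K I P D s l k cutI) //.
- rewrite /cutI eqxx ideal_pow_region (ideal_of_ext K eqPhi) /staircase_above.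
  by apply: ideal_of_ext => x y; rewrite /right_of add0n.
- rewrite cutIE // /comp_C eqxx AE //.
  exact: (link_first K chain_gt0 xs_incr ys_decr xs1 ysk ah hY rvY cutb PhiP).
- move=> i m ik ltm; rewrite !cutIE // HE //.
  exact: (link_H K chain_gt0 xs_incr ys_decr xs1 ysk ah hY hpos rvY cutb aPhi vPhi PhiP ik ltm).
move=> i ik; rewrite cutIE // /comp_C; have -> : (i == 0) = false by lia.
case: eqP => [eik | neik].
  rewrite /cutI eik eqxx BE; last by rewrite leqnn chain_gt0.
  exact: (link_last K chain_gt0 xs_incr ys_decr xs1 ysk ah hY hpos rvY cutb aPhi vPhi PhiP).
have ltik : i < k by lia.
have ik' : 0 < i.+1 <= k by lia.
have i0 : 0 < i by lia.
rewrite cutIE // !AE // !BE //.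
have [_ ->] := uv_atE ik'; have [-> _] := uv_atE ik.
exact: (link_C K chain_gt0 xs_incr ys_decr xs1 ysk ah hY hpos rvY cutb aPhi vPhi PhiP i0 ltik).
Qed.

End Persistence.

Local Open Scope ring_scope.

Theorem theorem5p4 (K : fieldType) (I : ideal K) (P : seq 'X_{1..2})
    (D s : nat) :
  monomial_ideal I -> anchored I -> ~ principal I ->
  sorted (fun g h : 'X_{1..2} => (h vy < g vy)%N) P ->
  (forall f, persistent I f -> f \in P) ->
  (forall f, f \in P -> weakly_persistent I f) ->
  (D_ I P <= D)%N ->
  D%:Z + r_y I P D + 1 <= s%:Z ->
  forall l : nat, eq_ideal (ideal_pow I (s + l)) (stable_link I P D s l).
Proof.
move=> monI ancI nonprI sortP persP wpersP leD les l.
have [F [aF [b0 Fb0] F0 eqI]] := anchored_right_of monI ancI nonprI.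
move: persP wpersP leD les; rewrite {monI ancI nonprI}eqI => persP wpersP leD les.
(* B is the least zero of the profile, that is dist_y(I). *)
have [B [_ cB FB _]] := last_corner b0 aF; rewrite Fb0 in FB.
have sizeP := sizePk aF FB cB F0 persP.
have vE i : (0 < i < size P)%N -> (0 < v_at K P i)%N.
  rewrite sizeP ltnS => ik; have [_ ->] := uv_atE aF FB cB F0 sortP persP wpersP ik.
  by rewrite subn_gt0; apply: (at_y_lt aF FB cB F0 sortP persP); lia.
have [ltDs bound] := r_y_bound vE les.
rewrite (power_stable_link aF FB cB F0 sortP persP wpersP l leD ltDs) // => i ik.
by rewrite -{1}(dist_vy_right_of K aF FB cB); apply: bound; rewrite sizeP ltnS.
Qed.
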